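(* Let $(\mathbb{A},+)$ be a finite Abelian group with $|\mathbb{A}|\ge 2$. There exists $0<\varepsilon_0<\frac{|\mathbb{A}|-1}{|\mathbb{A}|}$ such that, for each $\varepsilon_0<\varepsilon\le\frac{|\mathbb{A}|-1}{|\mathbb{A}|}$, the factor filtration $(\mathscr{F}^{\tau_\varepsilon},\sigma)$ is dynamically standard.
   Context: Conventions: probability spaces are Polish spaces with their Borel $\sigma$-algebra; random variables take values in Polish spaces; $\mathcal{L}(X)$ is the law of $X$. $\Sigma(X_m:m\in I)$ denotes the $\sigma$-algebra generated by the $X_m$, $m\in I$, and the negligible sets; all $\sigma$-algebras are complete and essentially separable. A filtration is a non-decreasing sequence $\mathscr{F}=(\mathscr{F}_n)_{n\le 0}$ of sub-$\sigma$-algebras on a probability space; it is generated by $(X_n)_{n\le0}$ if $\mathscr{F}_n=\Sigma(X_m:m\le n)$ for all $n\le 0$. $\mathscr{F}$ is immersed in $\mathscr{G}$ (same space) if $\mathscr{F}_n\subset\mathscr{G}_n$ for all $n\le0$ and, for all $n\le-1$, $\mathscr{F}_{n+1}$ and $\mathscr{G}_n$ are independent conditionally to $\mathscr{F}_n$. Dynamical notions: A dynamical system $(\Omega,\mathbb{P},T)$ is a probability space with an invertible bi-measurable $\mathbb{P}$-preserving map $T$. A factor $\sigma$-algebra is a sub-$\sigma$-algebra $\mathscr{A}$ with $T^{-1}A,TA\in\mathscr{A}$ for all $A\in\mathscr{A}$. A $T$-process is a process $(Y(i))_{i\in\mathbb{Z}}$ with $Y(i)=Y(0)\circ T^i$.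 A factor filtration is a pair $(\mathscr{F},T)$ where $\mathscr{F}$ is a filtration on $(\Omega,\mathbb{P})$, $(\Omega,\mathbb{P},T)$ is a dynamical system, and each $\mathscr{F}_n$ is a factor $\sigma$-algebra. $(\mathscr{F},T)$ and $(\mathscr{F}',T')$ (possibly on different dynamical systems) are dynamically isomorphic if there are processes $X=(X_n)_{n\le0}$ and $X'=(X'_n)_{n\le0}$ generating $\mathscr{F}$ and $\mathscr{F}'$ respectively, where each $X_n=(X_n(i))_{i\in\mathbb{Z}}$ is a $T$-process, each $X'_n=(X'_n(i))_{i\in\mathbb{Z}}$ is a $T'$-process, and $\mathcal{L}(X)=\mathcal{L}(X')$. $(\mathscr{F},T)$ is dynamically immersible in $(\mathscr{G},S)$ if there is a factor filtration $(\mathscr{F}',S)$, dynamically isomorphic to $(\mathscr{F},T)$, with $\mathscr{F}'$ immersed in $\mathscr{G}$. $(\mathscr{F},T)$ is dynamically of product type if there are independent factor $\sigma$-algebras $(\mathscr{G}_n)_{n\le0}$ with $\mathscr{F}_n=\bigvee_{m\le n}\mathscr{G}_m$ for all $n\le 0$. $(\mathscr{F},T)$ is dynamically standard if it is dynamically immersible in some factor filtration that is dynamically of product type. Construction of $(\mathscr{F}^{\tau_\varepsilon},\sigma)$: $\tau:\mathbb{A}^{\mathbb{Z}}\to\mathbb{A}^{\mathbb{Z}}$, $\tau x(i)=x(i)+x(i+1)$. $\tau_\varepsilon$ is the Markov kernel on $\mathbb{A}^{\mathbb{Z}}$ for which $\tau_\varepsilon(x,\cdot)$ is the law of $\tau x+\xi$,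 where $\xi=(\xi(i))_{i\in\mathbb{Z}}$ has i.i.d. coordinates with $\xi(i)=0_{\mathbb{A}}$ with probability $1-\varepsilon$ and $\xi(i)=a$ with probability $\frac{\varepsilon}{|\mathbb{A}|-1}$ for each $a\ne0_{\mathbb{A}}$. Let $\mu$ be the product measure on $\mathbb{A}^{\mathbb{Z}}$ with uniform marginals; it is $\tau_\varepsilon$-invariant. On $\Omega=(\mathbb{A}^{\mathbb{Z}})^{\mathbb{Z}}$ let $\mathbb{P}$ be the law of the stationary Markov chain $(X_n)_{n\in\mathbb{Z}}$ with $\mathcal{L}(X_n)=\mu$ and $\mathcal{L}(X_{n+1}\mid X_n=x)=\tau_\varepsilon(x,\cdot)$, with $X_n$ the coordinate maps; $\mathscr{F}^{\tau_\varepsilon}_n=\Sigma(X_m:m\le n)$ for $n\le0$. The map $\sigma$ is the left shift acting on every row, $(x_n(i))_{n,i}\mapsto(x_n(i+1))_{n,i}$; it preserves $\mathbb{P}$ and each $\mathscr{F}^{\tau_\varepsilon}_n$ is $\sigma$-invariant. *)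

(* Defs.v *)
From HB Require Import structures.
From mathcomp Require Import all_boot all_order all_algebra.
From mathcomp Require Import all_classical all_reals all_analysis.

Set Implicit Arguments.
Unset Strict Implicit.
Unset Printing Implicit Defensive.

Import Order.TTheory GRing.Theory Num.Theory.
Import numFieldNormedType.Exports.

Local Open Scope classical_set_scope.
Local Open Scope ring_scope.

(* Filtrations and processes whose time n ranges over the non-positive
   integers are families indexed by k : nat, with k standing for n = -k.
   Thus "m <= n" becomes "k <= l" and the successor of time -k.+1 is -k. *)

Definition product_display (d : measure_display) : measure_display.
Proof. exact d. Qed.

Section ProductSpace.
Context (I : Type) (d : measure_display) (T : I -> measurableType d).

Definition prod_space : Type := forall i, T i.

Definition cylinders : set_system (forall i, T i) :=
  \bigcup_i preimage_set_system setT (fun x => x i) measurable.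

HB.instance Definition _ := Pointed.copy prod_space (forall i, T i).

HB.instance Definition _ := @isMeasurable.Build (product_display d)
  prod_space <<s cylinders >> (@sigma_algebra0 _ setT cylinders)
  (@sigma_algebraC _ cylinders) (@sigma_algebra_bigcup _ setT cylinders).

End ProductSpace.

(* The sigma-algebra of T is the Borel sigma-algebra of a Polish topology,
   given here as the one transported from M along the bijection f. *)
Definition polish (R : realType) (d : measure_display)
    (T : measurableType d) : Prop :=
  exists (M : completePseudoMetricType R) (f : T -> M),
    [/\ hausdorff_space M,
        (exists2 D : set M, countable D & dense D),
        bijective f &
        @measurable d T = preimage_set_system setT f <<s @open M >>].

Section SigmaAlgebras.
Context (R : realType) (d : measure_display) (Omega : measurableType d).
Variable P : probability Omega R.

(* Omega carries its Borel sigma-algebra only, so completeness of a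
   sub-sigma-algebra means that it contains all events of probability 0. *)
Definition null_events : set_system Omega :=
  [set N | measurable N /\ P N = 0%E].

(* Essential separability is not a separate requirement: it holds for every
   sub-sigma-algebra as soon as Omega is Polish. *)
Definition complete_subsigma (F : set_system Omega) : Prop :=
  [/\ sigma_algebra setT F, F `<=` measurable & null_events `<=` F].

Definition Sigma (J : Type) (D : set J) (d' : measure_display)
    (E : J -> measurableType d') (X : forall j, Omega -> E j) :
    set_system Omega :=
  <<s (\bigcup_(j in D) preimage_set_system setT (X j) measurable)
      `|` null_events >>.

Definition filtration (F : nat -> set_system Omega) : Prop :=
  (forall k, complete_subsigma (F k)) /\ (forall k, F k.+1 `<=` F k).

Definition generated_by (F : nat -> set_system Omega) (d' : measure_display)
    (E : nat -> measurableType d') (X : forall k, Omega -> E k) : Prop :=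
  forall k, F k = Sigma [set l | (k <= l)%N] X.

(* f is a version of the conditional probability P(A | C). *)
Definition cond_prob (C : set_system Omega) (A : set Omega)
    (f : Omega -> R) : Prop :=
  [/\ forall B : set R, measurable B -> C (f @^-1` B),
      P.-integrable setT (EFin \o f) &
      forall D, C D -> (\int[P]_(x in D) (f x)%:E = P (A `&` D))%E].

Definition cond_independent (C F G : set_system Omega) : Prop :=
  forall A B, F A -> G B ->
    exists f g : Omega -> R,
      [/\ cond_prob C A f, cond_prob C B g &
          cond_prob C (A `&` B) (f \* g)].

Definition immersed (F G : nat -> set_system Omega) : Prop :=
  (forall k, F k `<=` G k) /\
  (forall k, cond_independent (F k.+1) (F k) (G k.+1)).

Definition independent (G : nat -> set_system Omega) : Prop :=
  forall (s : seq nat) (A : nat -> set Omega),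
    uniq s -> (forall k, k \in s -> G k (A k)) ->
    (P (\bigcap_(k in [set` s]) A k) = \prod_(k <- s) P (A k))%E.

End SigmaAlgebras.

Record invertible_map (Omega : Type) := InvertibleMap {
  fwd :> Omega -> Omega;
  bwd : Omega -> Omega;
  fwdK : cancel fwd bwd;
  bwdK : cancel bwd fwd }.

Definition iterz (Omega : Type) (T : invertible_map Omega) (i : int) :
    Omega -> Omega :=
  match i with
  | Posz n => iter n (fwd T)
  | Negz n => iter n.+1 (bwd T)
  end.

Section Dynamics.
Context (R : realType) (d : measure_display) (Omega : measurableType d).
Variables (P : probability Omega R) (T : invertible_map Omega).

Definition dynamical_system : Prop :=
  [/\ polish R Omega, measurable_fun setT (fwd T),
      measurable_fun setT (bwd T) &
      forall A, measurable A -> P (T @^-1` A) = P A].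

Definition factor_sigma (G : set_system Omega) : Prop :=
  complete_subsigma P G /\
  (forall A, G A -> G (T @^-1` A) /\ G (T @` A)).

Definition factor_filtration (F : nat -> set_system Omega) : Prop :=
  [/\ dynamical_system, filtration P F & forall k, factor_sigma (F k)].

Definition T_process (d' : measure_display) (E : measurableType d')
    (Y : Omega -> prod_space (fun _ : int => E)) : Prop :=
  measurable_fun setT Y /\ forall i w, Y w i = Y (iterz T i w) 0.

Definition product_type (F : nat -> set_system Omega) : Prop :=
  exists G : nat -> set_system Omega,
    [/\ forall k, factor_sigma (G k), independent P G &
        forall k, F k = <<s \bigcup_(l in [set l | (k <= l)%N]) G l >>].

End Dynamics.

Section Isomorphism.
Context (R : realType).
Context (d : measure_display) (Omega : measurableType d).
Variables (P : probability Omega R) (T : invertible_map Omega).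
Context (d' : measure_display) (Omega' : measurableType d').
Variables (P' : probability Omega' R) (T' : invertible_map Omega').

Definition same_law (e : measure_display) (E : measurableType e)
    (X : Omega -> E) (X' : Omega' -> E) : Prop :=
  forall B, measurable B -> pushforward P X B = pushforward P' X' B.

Definition dynamically_isomorphic (F : nat -> set_system Omega)
    (F' : nat -> set_system Omega') : Prop :=
  exists (e : measure_display) (E : nat -> measurableType e)
    (X : forall k, Omega -> prod_space (fun _ : int => E k))
    (X' : forall k, Omega' -> prod_space (fun _ : int => E k)),
    [/\ forall k, polish R (E k),
        (forall k, T_process T (X k)) /\ (forall k, T_process T' (X' k)),
        generated_by P F X /\ generated_by P' F' X' &
        same_law
          (fun w => (X^~ w) : prod_space (fun k => prod_space (fun _ => E k)))
          (fun w => (X'^~ w) : prod_space (fun k => prod_space (fun _ => E k)))].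

End Isomorphism.

Section Standardness.
Context (R : realType).
Context (d : measure_display) (Omega : measurableType d).
Variables (P : probability Omega R) (T : invertible_map Omega).

Definition dynamically_immersible (F : nat -> set_system Omega)
    (d' : measure_display) (Omega' : measurableType d')
    (P' : probability Omega' R) (S : invertible_map Omega')
    (G : nat -> set_system Omega') : Prop :=
  exists F' : nat -> set_system Omega',
    [/\ factor_filtration P' S F', dynamically_isomorphic P T P' S F F' &
        immersed P' F' G].

Definition dynamically_standard (F : nat -> set_system Omega) : Prop :=
  exists (d' : measure_display) (Omega' : measurableType d')
    (P' : probability Omega' R) (S : invertible_map Omega')
    (G : nat -> set_system Omega'),
    [/\ factor_filtration P' S G, product_type P' S G &
        dynamically_immersible F P' S G].

End Standardness.

Definition discrete (A : finZmodType) : Type := A.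

HB.instance Definition _ (A : finZmodType) := FinRing.Zmodule.on (discrete A).
HB.instance Definition _ (A : finZmodType) := isPointed.Build (discrete A) 0.
HB.instance Definition _ (A : finZmodType) :=
  @isMeasurable.Build default_measure_display (discrete A)
    discrete_measurable discrete_measurable0
    discrete_measurableC discrete_measurableU.

Section Chain.
Context (R : realType) (A : finZmodType).

Definition row_space := prod_space (fun _ : int => discrete A).
Definition path_space := prod_space (fun _ : int => row_space).

HB.instance Definition _ := Measurable.on row_space.
HB.instance Definition _ := Measurable.on path_space.

Definition iid_law (p : A -> R) (mu : probability row_space R) : Prop :=
  forall (s : seq int) (a : int -> A), uniq s ->
    mu [set x | forall i, i \in s -> x i = a i] =
    (\prod_(i <- s) p (a i))%:E.

Definition uniform_pmf (a : A) : R := #|A|%:R^-1.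

Definition noise_pmf (eps : R) (a : A) : R :=
  if a == 0 then 1 - eps else eps / (#|A|%:R - 1).

Definition tau (x : row_space) : row_space := fun i => x i + x (i + 1).

(* nu is the law of the noise xi; tau_kernel nu x is the law of tau x + xi. *)
Definition tau_kernel (nu : probability row_space R) (x : row_space) :
    set row_space -> \bar R :=
  pushforward nu (fun xi => (fun i => tau x i + xi i) : row_space).

Definition chain_row (n : int) (x : path_space) : row_space := x n.

Definition stationary_chain (mu : probability row_space R)
    (K : row_space -> set row_space -> \bar R)
    (P : probability path_space R) : Prop :=
  forall (n : int) (B : set row_space), measurable B ->
    P (chain_row n @^-1` B) = mu B /\
    (forall C, Sigma P [set m : int | m <= n] chain_row C ->
       P (C `&` chain_row (n + 1) @^-1` B) =
       (\int[P]_(x in C) K (chain_row n x) B)%E).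

(* These conditions determine P uniquely. *)
Definition chain_law (eps : R) (P : probability path_space R) : Prop :=
  exists mu nu : probability row_space R,
    [/\ iid_law uniform_pmf mu, iid_law (noise_pmf eps) nu &
        stationary_chain mu (tau_kernel nu) P].

Definition chain_filtration (P : probability path_space R) (k : nat) :
    set_system path_space :=
  Sigma P [set m : int | m <= - k%:Z] chain_row.

Definition row_shift_fwd (x : path_space) : path_space := fun n i => x n (i + 1).
Definition row_shift_bwd (x : path_space) : path_space := fun n i => x n (i - 1).

Lemma row_shift_fwdK : cancel row_shift_fwd row_shift_bwd.
Proof.
move=> x; apply/funext => n; apply/funext => i.
by rewrite /row_shift_bwd /row_shift_fwd subrK.
Qed.

Lemma row_shift_bwdK : cancel row_shift_bwd row_shift_fwd.
Proof.
move=> x; apply/funext => n; apply/funext => i.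
by rewrite /row_shift_bwd /row_shift_fwd addrK.
Qed.

Definition row_shift : invertible_map path_space :=
  InvertibleMap row_shift_fwdK row_shift_bwdK.

End Chain.

(* Main.v *)
Require Import Defs.
From HB Require Import structures.
From mathcomp Require Import all_boot all_order all_algebra.
From mathcomp Require Import all_classical all_reals all_analysis.
From mathcomp Require Import measurable_realfun.
From mathcomp Require Import lra zify ring.

Set Implicit Arguments.
Unset Strict Implicit.
Unset Printing Implicit Defensive.

Import Order.TTheory GRing.Theory Num.Theory.
Import numFieldNormedType.Exports.

Local Open Scope classical_set_scope.
Local Open Scope ring_scope.

(** Write X n i for the chain and xi n i = X n i - X (n-1) i - X (n-1) (i+1)
for its noise. The noise kernel gives mass 1 - eps to 0 and mass r = eps /
(#|A| - 1) to every other element. For eps <= (#|A| - 1) / #|A| one has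
r <= 1 - eps, so that the law of the noise is the sum of r times the counting
measure of A and of a mass rho = 1 - #|A| r at 0. To realise this decomposition, the space of the chain is
multiplied by an independent field V of Bernoulli variables of parameter beta =
r / (1 - eps), and the site (n, i) is called refreshed when xi n i <> 0 or V n
i holds. Its innovation is Some (X n i) if it is refreshed and None otherwise.

Whatever the past, the innovation at (n, i) takes each value Some a with
probability r and the value None with probability rho, independently over i.
Hence each row of innovations is independent of the whole past
([innovation_independent]), and the filtration of the innovations is
dynamically of product type ([innovation_product_type]).

The innovations determine the chain. At a site that is not refreshed, X n i = X
(n-1) i + X (n-1) (i+1), so X n i can be computed from two sites of the
previous row, and so on backwards until refreshed sites are met. This
exploration is dominated by a branching process with mean offspring 2 rho: it
has not stopped after N generations with probability at most (2 rho)^N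
([decode_failure]). The choice eps0 = (#|A| - 1) / (2 #|A|) is the value of eps
at which 2 rho = 1, and above it X n i is almost surely a function of the
innovations up to time n ([site_decoded]).

The chain is still the first coordinate of the enlarged space, so that its
filtration there is isomorphic to the original one for free
([rows_isomorphic]), and by the above it is contained in the filtration of the
innovations. It is immersed in it because the innovations up to time n depend
only on the rows of X up to time n and on V, and V is independent of X: by
Fubini, the conditional probability of an event of V and the past given the
whole chain is the measure of its section, which depends only on the past of
the chain ([rows_cond_independent]).

The remaining parts provide the tools: uniqueness of measures on cylinders,
null sets, the Polish structure of the configuration spaces, the invariance of
the law of the chain under the shift, which the definition of the chain does
not contain ([row_shift_preserving]), the existence of a Bernoulli field
([exists_bernoulli]) and conditional probabilities from the Radon-Nikodym
theorem ([cond_prob_density]). *)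

(** * Measures determined by cylinders *)

Section PiSystem.
Context (R : realType) (d : measure_display) (Omega : measurableType d).
Implicit Types m : {measure set Omega -> \bar R}.

Lemma pi_system_unique (G : set_system Omega) m1 m2 :
  G `<=` measurable -> setI_closed G -> G setT -> (m1 setT < +oo)%E ->
  (forall E, G E -> m1 E = m2 E) -> forall E, <<s G >> E -> m1 E = m2 E.
Proof.
move=> mG IG GT m1oo eqG E GE.
apply: (g_sigma_algebra_measure_unique G mG (fun=> setT)) => //.
by rewrite bigcup_const//; exists 0%N.
Qed.

End PiSystem.

Section Cylinders.
Context (I : eqType) (B : Type) (Omega : pointedType) (Y : I -> Omega -> B).

Definition cyl (s : seq I) (a : I -> B) : set Omega :=
  [set w | forall i, i \in s -> Y i w = a i].

Definition site_events (D : set I) : set_system Omega :=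
  [set E | exists i b, D i /\ E = Y i @^-1` [set b]].

(** The empty set is added because two cylinders with contradictory values are
    disjoint; with it the cylinders form a pi-system. *)
Definition cylinder_system (D : set I) : set_system Omega :=
  [set E | E = set0 \/ exists s a, (forall i, i \in s -> D i) /\ E = cyl s a].

Lemma cyl_nil a : cyl [::] a = setT.
Proof. by apply/seteqP; split. Qed.

Lemma cyl_cat s t a : cyl (s ++ t) a = cyl s a `&` cyl t a.
Proof.
apply/seteqP; split => w /=.
  by move=> h; split => i si; apply: h; rewrite mem_cat si ?orbT.
by case=> hs ht i; rewrite mem_cat => /orP[/hs|/ht].
Qed.

Lemma cyl_cons z s a : cyl (z :: s) a = (Y z @^-1` [set a z]) `&` cyl s a.
Proof.
apply/seteqP; split => w /=.
  by move=> h; split; [exact/h/mem_head|move=> i si; apply/h/mem_behead].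
by case=> hz hs i; rewrite inE => /orP[/eqP->|/hs].
Qed.

Lemma eq_cyl s a b : (forall i, i \in s -> a i = b i) -> cyl s a = cyl s b.
Proof.
by move=> ab; apply/seteqP; split => w h i si; rewrite h// ab.
Qed.

Lemma eq_mem_cyl s t a : s =i t -> cyl s a = cyl t a.
Proof.
by move=> st; apply/seteqP; split => w h i si; apply: h; rewrite ?st// -st.
Qed.

Lemma cyl_meet s a t b :
  cyl s a `&` cyl t b = set0 \/
  exists c, cyl s a `&` cyl t b = cyl (s ++ t) c.
Proof.
have [/eqP|/set0P[w [ws wt]]] := boolP (cyl s a `&` cyl t b == set0).
  by left.
right; exists (Y^~ w); rewrite cyl_cat; congr (_ `&` _); apply: eq_cyl => i si.
- by rewrite ws.
- by rewrite wt.
Qed.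

Lemma cylinder_system_setI D : setI_closed (cylinder_system D).
Proof.
move=> E F [->|[s [a [sD ->]]]]; first by move=> _; rewrite set0I; left.
move=> [->|[t [b [tD ->]]]]; first by rewrite setI0; left.
have [->|[c ->]] := cyl_meet s a t b; first by left.
by right; exists (s ++ t), c; split => // i; rewrite mem_cat => /orP[/sD|/tD].
Qed.

Lemma cylinder_system_setT D : cylinder_system D setT.
Proof.
have [[a _]|na] := pselect (exists a : I -> B, True).
  by right; exists [::], a; rewrite cyl_nil.
by left; apply/seteqP; split => // w _; case: na; exists (Y^~ w).
Qed.

Lemma site_events_cylinder D : site_events D `<=` cylinder_system D.
Proof.
move=> _ [i [b [Di ->]]]; right; exists [:: i], (fun=> b).
split; first by move=> j; rewrite inE => /eqP->.
by rewrite cyl_cons cyl_nil setIT.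
Qed.

Lemma cyl_sigma D s a :
  (forall i, i \in s -> D i) -> <<s site_events D >> (cyl s a).
Proof.
elim: s => [|z s IHs] sD.
  by rewrite cyl_nil; exact: (@measurableT _ (g_sigma_algebraType (site_events D))).
rewrite cyl_cons; apply: (@measurableI _ (g_sigma_algebraType (site_events D))).
  by apply: sub_sigma_algebra; exists z, (a z); split => //; exact/sD/mem_head.
by apply: IHs => i si; apply/sD/mem_behead.
Qed.

Lemma site_events_sub D D' : D `<=` D' -> site_events D `<=` site_events D'.
Proof. by move=> DD' _ [i [b [Di ->]]]; exists i, b; split => //; exact: DD'. Qed.

End Cylinders.

Section CylinderMeasures.
Context (R : realType) (d : measure_display) (Omega : measurableType d).
Context (I : eqType) (B : finType) (Y : I -> Omega -> B).
Hypothesis mY : forall i b, measurable (Y i @^-1` [set b]).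
Implicit Types m : {measure set Omega -> \bar R}.

Lemma site_events_measurable D : <<s site_events Y D >> `<=` measurable.
Proof.
apply: smallest_sub; first exact: sigma_algebra_measurable.
by move=> _ [i [b [_ ->]]].
Qed.

Lemma cyl_measurable s a : measurable (cyl Y s a).
Proof. exact: (@site_events_measurable setT _ (cyl_sigma _ _)). Qed.

Lemma cylinder_system_measurable D : cylinder_system Y D `<=` measurable.
Proof. by move=> _ [->|[s [a [_ ->]]]]//; exact: cyl_measurable. Qed.

(** Only duplicate-free lists of sites are required: product formulas for the
    measure of a cylinder are valid for these alone. *)
Lemma cyl_unique (D : set I) m1 m2 : (m1 setT < +oo)%E ->
  (forall s a, (forall i, i \in s -> D i) -> uniq s ->
     m1 (cyl Y s a) = m2 (cyl Y s a)) ->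
  forall E, <<s site_events Y D >> E -> m1 E = m2 E.
Proof.
move=> m1oo eqm E DE.
apply: (@pi_system_unique _ _ _ (cylinder_system Y D)) => //.
- exact: cylinder_system_measurable.
- exact: cylinder_system_setI.
- exact: cylinder_system_setT.
- move=> _ [->|[s [a [sD ->]]]]; first by rewrite !measure0.
  have su : undup s =i s by exact: mem_undup.
  rewrite -(eq_mem_cyl _ _ su); apply: eqm; last exact: undup_uniq.
  by move=> i; rewrite su => /sD.
- by move: E DE; apply: sub_sigma_algebra2; exact: site_events_cylinder.
Qed.

Lemma site_partition E z :
  E = \bigcup_(b in [set: B]) (E `&` (Y z @^-1` [set b])).
Proof.
by rewrite -setI_bigcupr -preimage_bigcup bigcup_imset1 image_id preimage_setT setIT.
Qed.

Lemma site_total m1 m2 E z : measurable E ->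
  (forall b, m1 (E `&` (Y z @^-1` [set b])) = m2 (E `&` (Y z @^-1` [set b]))) ->
  m1 E = m2 E.
Proof.
move=> mE eqm; rewrite (site_partition E z).
have tE : trivIset [set: B] (fun b => E `&` (Y z @^-1` [set b])).
  by apply/trivIsetP => b c _ _ bc; apply/seteqP; split => // w [[_ /= wb] [_ /= wc]];
    rewrite -wb -wc eqxx in bc.
have mF b : measurable (E `&` (Y z @^-1` [set b])) by exact: measurableI.
rewrite !measure_fin_bigcup//; try exact: finite_finset.
exact: (f_equal (fun F : B -> \bar R => \sum_(b \in [set: B]) F b)%E
  (funext eqm)).
Qed.

(** Law of total probability over the values at finitely many sites, in the
    form of a comparison of two measures; applied to restrictions and multiples
    of a measure, it allows one to condition on these values. *)
Lemma cyl_total m1 m2 E s : measurable E ->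
  (forall a, m1 (E `&` cyl Y s a) = m2 (E `&` cyl Y s a)) -> m1 E = m2 E.
Proof.
move=> mE; elim: s => [|z s IHs] eqm.
  have [[a _]|na] := pselect (exists a : I -> B, True).
    by have := eqm a; rewrite cyl_nil setIT.
  suff -> : E = set0 by rewrite !measure0.
  by apply/seteqP; split => // w _; case: na; exists (Y^~ w).
apply: IHs => a; apply: (@site_total _ _ _ z).
  by apply: measurableI => //; exact: cyl_measurable.
move=> b; have [zs|zs] := boolP (z \in s).
  have [<-|ab] := eqVneq (a z) b.
    by have := eqm a; rewrite cyl_cons setICA setIC.
  rewrite (_ : _ `&` _ = set0) ?measure0//.
  by apply/seteqP; split => // w [[_ /(_ _ zs) waz] /= wb]; rewrite -waz wb eqxx in ab.
have := eqm (fun i => if i == z then b else a i).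
rewrite cyl_cons eqxx -(@eq_cyl _ _ _ _ s a).
  by rewrite setICA setIC.
by move=> i si; case: eqP => // iz; rewrite -iz si in zs.
Qed.

(** It is enough to compare two measures on a cofinal family of finite sets of
    sites, since the smaller cylinders are finite unions of larger ones. *)
Lemma cyl_sub_eq m1 m2 s t : {subset s <= t} ->
  (forall a, m1 (cyl Y t a) = m2 (cyl Y t a)) ->
  forall a, m1 (cyl Y s a) = m2 (cyl Y s a).
Proof.
move=> st eqm a; apply: (@cyl_total _ _ _ t); first exact: cyl_measurable.
move=> b; have [->|[c ->]] := cyl_meet Y s a t b; first by rewrite !measure0.
suff /eq_mem_cyl-> : s ++ t =i t by [].
by move=> i; rewrite mem_cat; case: (boolP (i \in s)) => // /st.
Qed.

End CylinderMeasures.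

(** * Null sets *)

Lemma preimage_sigma_sub (T T' : Type) (f : T -> T') (G : set_system T)
    (C : set_system T') : sigma_algebra setT G ->
  (forall E, C E -> G (f @^-1` E)) -> forall E, <<s C >> E -> G (f @^-1` E).
Proof.
move=> [G0 GC GU] CG; apply: smallest_sub => //; split.
- by rewrite preimage_set0.
- by move=> E GE; rewrite setTD preimage_setC -setTD; exact: GC.
- by move=> F GF; rewrite preimage_bigcup; exact: GU.
Qed.

Section NullSets.
Context (R : realType) (d : measure_display) (Omega : measurableType d).
Variable P : probability Omega R.
Implicit Types (C : set_system Omega) (E F : set Omega).

(** The filtrations below, the factors and the layers all have this form.  Each
    event of such a sigma-algebra is equal, up to a null set, to an event of
    the sigma-algebra generated by C alone ([null_completion_mod]), which is
    how null sets are disposed of. *)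
Definition null_completion C : set_system Omega :=
  <<s C `|` null_events P >>.

Lemma null_completion_measurable C :
  C `<=` measurable -> null_completion C `<=` measurable.
Proof.
move=> mC; apply: smallest_sub; first exact: sigma_algebra_measurable.
by move=> E [/mC//|[]].
Qed.

Lemma null_completion_complete C :
  C `<=` measurable -> complete_subsigma P (null_completion C).
Proof.
move=> mC; split; first exact: smallest_sigma_algebra.
  exact: null_completion_measurable.
by move=> N nN; apply: sub_sigma_algebra; right.
Qed.

Lemma sub_null_completion C C' : C `<=` null_completion C' ->
  null_completion C `<=` null_completion C'.
Proof.
move=> CC'; apply: smallest_sub; first exact: smallest_sigma_algebra.
by move=> E [/CC'//|nE]; apply: sub_sigma_algebra; right.
Qed.

Lemma sigma_null_completion C : <<s C >> `<=` null_completion C.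
Proof. by apply: sub_sigma_algebra2 => E; left. Qed.

Lemma null_events0 : null_events P set0.
Proof. by split; rewrite ?measure0. Qed.

Lemma null_eventsU (F : nat -> set Omega) :
  (forall n, null_events P (F n)) -> null_events P (\bigcup_n F n).
Proof.
move=> nF; split; first by apply: bigcupT_measurable => n; exact: (nF n).1.
have : P.-negligible (\bigcup_n F n).
  apply: negligible_bigcup => n; exists (F n); split => //; first exact: (nF n).1.
  exact: (nF n).2.
by case=> N [mN PN FN]; apply: subset_measure0 PN => //;
   apply: bigcupT_measurable => n; exact: (nF n).1.
Qed.

Lemma null_eventsU2 E F :
  null_events P E -> null_events P F -> null_events P (E `|` F).
Proof.
move=> nE nF; rewrite -bigcup2inE bigcup_mkcond; apply: null_eventsU => n.
by case: ifPn => _; [case: n => [|[|n]]//=|]; exact: null_events0.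
Qed.

Definition eq_mod_null E F :=
  exists2 N, null_events P N & E `\` N = F `\` N.

Lemma eq_mod_null_refl E : eq_mod_null E E.
Proof. by exists set0 => //; exact: null_events0. Qed.

Lemma eq_mod_nullI E E' F F' : eq_mod_null E E' -> eq_mod_null F F' ->
  eq_mod_null (E `&` F) (E' `&` F').
Proof.
move=> [N nN eN] [M nM eM]; exists (N `|` M); first exact: null_eventsU2.
have key X Y : (X `&` Y) `\` (N `|` M) = ((X `\` N) `\` M) `&` ((Y `\` M) `\` N).
  by apply/seteqP; split => w /=; tauto.
by rewrite !key eN eM.
Qed.

Lemma eq_mod_null_measure E F : measurable E -> measurable F ->
  eq_mod_null E F -> P E = P F.
Proof.
move=> mE mF [N [mN PN] EF].
have key X : measurable X -> P X = P (X `\` N).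
  move=> mX; rewrite (measureDI P mX mN) [X in (_ + X)%E](_ : _ = 0%E) ?adde0//.
  by apply: subset_measure0 PN => //; exact: measurableI.
by rewrite (key E)// (key F)// EF.
Qed.

(** The events equal to a member of the generated sigma-algebra outside a null
    set form a sigma-algebra: a complement needs no new null set, and a
    countable union needs the union of the null sets. *)
Lemma null_completion_mod C E :
  null_completion C E -> exists2 E0, <<s C >> E0 & eq_mod_null E E0.
Proof.
move: E; apply: smallest_sub.
  split.
  - by exists set0; [exact: sigma_algebra0|exact: eq_mod_null_refl].
  - move=> E [E0 CE0 [N nN EE0]]; exists (setT `\` E0).
      exact: sigma_algebraCD.
    exists N => //; rewrite !setTD.
    have key X : ~` X `\` N = ~` (X `\` N) `\` N.
      by apply/seteqP; split => w /=; tauto.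
    by rewrite key EE0 -key.
  - move=> F hF.
    have /choice[G hG] : forall n, exists GN : set Omega * set Omega,
        [/\ <<s C >> GN.1, null_events P GN.2 & F n `\` GN.2 = GN.1 `\` GN.2].
      by move=> n; have [E0 CE0 [N nN EN]] := hF n; exists (E0, N).
    pose F0 n := (G n).1; pose N n := (G n).2.
    have CF n : <<s C >> (F0 n) by have [] := hG n.
    have FN n : null_events P (N n) by have [] := hG n.
    have FE n : F n `\` N n = F0 n `\` N n by have [] := hG n.
    exists (\bigcup_n F0 n).
      exact: sigma_algebra_bigcup.
    exists (\bigcup_n N n); first exact: null_eventsU.
    have key H : \bigcup_n H n `\` \bigcup_n N n =
        \bigcup_n (H n `\` N n) `\` \bigcup_n N n.
      apply/seteqP; split => w /= [[n _ Gn] Nn]; split => //; exists n => //.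
        by split=> // Nnw; apply: Nn; exists n.
      by case: Gn.
    by rewrite key (eq_bigcupr (fun n _ => FE n)) -key.
move=> E [CE|nE].
  by exists E; [exact: sub_sigma_algebra|exact: eq_mod_null_refl].
exists set0; first exact: sigma_algebra0.
by exists E => //; rewrite setDv set0D.
Qed.

Lemma complete_eq_mod G E F : complete_subsigma P G ->
  measurable E -> eq_mod_null E F -> G F -> G E.
Proof.
move=> [sG mG nG] mE [N nN EF] GF.
have GN : G N by exact: nG.
have GI X Y : G X -> G Y -> G (X `&` Y).
  move=> GX GY; rewrite -(sigma_algebra_id sG).
  by apply: (@measurableI _ (g_sigma_algebraType G)); exact: sub_sigma_algebra.
have GU X Y : G X -> G Y -> G (X `|` Y).
  move=> GX GY; rewrite -(sigma_algebra_id sG).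
  by apply: (@measurableU _ (g_sigma_algebraType G)); exact: sub_sigma_algebra.
have GC X : G X -> G (~` X) by move=> GX; rewrite -setTD; case: sG => _ + _; exact.
(* Outside N, E and F agree; inside N, E is a null set. *)
have -> : E = (F `&` ~` N) `|` (E `&` N).
  by rewrite -setDE -EF setDE -setIUr setUC setUv setIT.
apply: GU; first by apply: GI => //; exact: GC.
apply: nG; case: nN => mN PN; split; first exact: measurableI.
by apply: subset_measure0 PN => //; exact: measurableI.
Qed.

Section Invariance.
Variable T : invertible_map Omega.
Hypothesis mT : measurable_fun setT (fwd T).
Hypothesis mTi : measurable_fun setT (bwd T).
Hypothesis PT : forall E, measurable E -> P (T @^-1` E) = P E.

Lemma image_bwd E : T @` E = bwd T @^-1` E.
Proof.
apply/seteqP; split => w /=; first by move=> [v Ev <-]; rewrite fwdK.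
by move=> Ew; exists (bwd T w) => //; rewrite bwdK.
Qed.

(** E is the preimage under T of its preimage under the inverse. *)
Lemma preserving_bwd E : measurable E -> P (bwd T @^-1` E) = P E.
Proof.
move=> mE; rewrite -PT; last by rewrite -[X in measurable X]setTI; exact: mTi.
by congr (P _); apply/seteqP; split => w /=; rewrite fwdK.
Qed.

Lemma null_completion_factor C : C `<=` measurable ->
  (forall E, C E -> C (T @^-1` E)) -> (forall E, C E -> C (bwd T @^-1` E)) ->
  factor_sigma P T (null_completion C).
Proof.
move=> mC CT CTi; split; first exact: null_completion_complete.
have key (f : Omega -> Omega) : measurable_fun setT f ->
    (forall E, measurable E -> P (f @^-1` E) = P E) ->
    (forall E, C E -> C (f @^-1` E)) ->
    forall E, null_completion C E -> null_completion C (f @^-1` E).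
  move=> mf Pf Cf; apply: preimage_sigma_sub; first exact: smallest_sigma_algebra.
  move=> E [CE|[mE PE]]; apply: sub_sigma_algebra; first by left; exact: Cf.
  right; split; last by rewrite Pf.
  by rewrite -[X in measurable X]setTI; exact: mf.
move=> E CE; split; first exact: key.
by rewrite image_bwd; apply: key => //; exact: preserving_bwd.
Qed.

End Invariance.

End NullSets.

Lemma preimage_row_sigma (I : Type) (A : finZmodType) (Omega : pointedType)
    (G : set_system Omega) (Y : Omega -> prod_space (fun _ : I => discrete A)) :
  sigma_algebra setT G ->
  (forall i a, G ((fun w => Y w i) @^-1` [set a])) ->
  forall B, measurable B -> G (Y @^-1` B).
Proof.
move=> sG GY; apply: preimage_sigma_sub => //.
move=> _ [i _ [B _ <-]]; rewrite setTI.
have -> : Y @^-1` ((fun x => x i) @^-1` B) =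
    \bigcup_(a in B) ((fun w => Y w i) @^-1` [set a]).
  by rewrite -preimage_bigcup bigcup_imset1 image_id.
rewrite -(sigma_algebra_id sG).
apply: (@fin_bigcup_measurable _ (g_sigma_algebraType G)).
  exact: (@finite_finset A).
by move=> a _; apply: sub_sigma_algebra.
Qed.

Lemma Sigma_rows (R : realType) (d : measure_display) (Omega : measurableType d)
    (P : probability Omega R) (J : eqType) (I : eqType) (A : finZmodType)
    (D : set J) (Z : J -> Omega -> prod_space (fun _ : I => discrete A)) :
  Sigma P D Z =
  null_completion P (site_events (fun (z : J * I) w => Z z.1 w z.2 : A)
    [set z | D z.1]).
Proof.
apply/seteqP; split; apply: smallest_sub; try exact: smallest_sigma_algebra.
- move=> E [[j Dj [B mB <-]]|nE]; last by apply: sub_sigma_algebra; right.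
  rewrite setTI; apply: preimage_row_sigma mB; first exact: smallest_sigma_algebra.
  by move=> i a; apply: sub_sigma_algebra; left; exists (j, i), a.
- move=> E [[[j i] [a [/= Dj ->]]]|nE]; last by apply: sub_sigma_algebra; right.
  apply: sub_sigma_algebra; left; exists j => //=.
  exists ((fun x => x i) @^-1` [set a]); last by rewrite setTI.
  by apply: sub_sigma_algebra; exists i => //; exists [set a]; rewrite ?setTI.
Qed.

(** * Polish spaces from countably many coordinates *)

Section Coding.
Context (T : pointedType) (B : countType).

(** The second axiom says that the set of codes is closed in the product of
    copies of B; it makes the metric below complete. *)
Record coding := Coding {
  code : nat -> T -> B;
  code_inj : forall x y, (forall n, code n x = code n y) -> x = y;
  code_closed : forall b : nat -> B,
    (forall N, exists x, forall n, (n < N)%N -> code n x = b n) ->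
    exists x, forall n, code n x = b n }.

Definition coded_space (R : realType) (c : coding) : Type := T.

Context (R : realType) (c : coding).

(** The ball of the ultrametric for which two points are at distance 1/(n+1)
    when n is the first coordinate at which they differ; the condition 0 < e is
    needed in the triangle inequality, which is required for all e1 and e2. *)
Definition coded_ball (x : T) (e : R) (y : T) : Prop :=
  0 < e /\ forall n, e * n.+1%:R <= 1 -> code c n x = code c n y.

Lemma coded_ball_center x (e : R) : 0 < e -> coded_ball x e x.
Proof. by []. Qed.

Lemma coded_ball_sym x y (e : R) : coded_ball x e y -> coded_ball y e x.
Proof. by case=> e0 xy; split => // n /xy. Qed.

Lemma coded_ball_triangle x y z (e1 e2 : R) :
  coded_ball x e1 y -> coded_ball y e2 z -> coded_ball x (e1 + e2) z.
Proof.
move=> [e10 xy] [e20 yz]; split; first exact: addr_gt0.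
move=> n; rewrite mulrDl => le1; rewrite xy ?yz//; apply: le_trans le1.
  by rewrite lerDr mulr_ge0// ltW.
by rewrite lerDl mulr_ge0// ltW.
Qed.

HB.instance Definition _ := Pointed.copy (coded_space R c) T.
HB.instance Definition _ :=
  hasNbhs.Build (coded_space R c) (nbhs_ (entourage_ coded_ball)).
HB.instance Definition _ := @Nbhs_isPseudoMetric.Build R (coded_space R c)
  (entourage_ coded_ball) erefl coded_ball coded_ball_center coded_ball_sym
  coded_ball_triangle erefl.

Lemma coded_ball_prefix (e : R) : 0 < e ->
  exists N, forall x y, (forall n, (n < N)%N -> code c n x = code c n y) ->
    coded_ball x e y.
Proof.
move=> e0; exists (Num.truncn e^-1).+1 => x y xy; split => // n en; apply: xy.
have ne : n.+1%:R <= e^-1 by rewrite -[leRHS]mul1r ler_pdivlMr// mulrC.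
have e1 : (0 : R) <= e^-1 by rewrite invr_ge0 ltW.
rewrite ltnS -(ler_nat R); apply: le_trans (_ : n.+1%:R <= _); first by rewrite ler_nat.
by rewrite ler_nat truncn_ge_nat.
Qed.

Lemma coded_ball_coord n x y : coded_ball x n.+1%:R^-1 y ->
  forall k, (k <= n)%N -> code c k x = code c k y.
Proof.
move=> [_ xy] k kn; apply: xy.
by rewrite mulrC ler_pdivrMr// mul1r ler_nat ltnS.
Qed.

(** Along a Cauchy filter every coordinate is eventually constant; the limits
    of the coordinates are realised by a point because the codes form a closed
    set. *)
Lemma coded_complete (F : set_system (coded_space R c)) :
  ProperFilter F -> cauchy F -> cvg F.
Proof.
move=> FF /cauchy_ballP cF.
have Fn n : exists b : B, F [set x | code c n x = b].
  have n0 : 0 < n.+1%:R^-1 :> R by rewrite invr_gt0.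
  have [[U V] /= [FU FV] UV] := cF _ n0.
  have [u Uu] := filter_ex FU; exists (code c n u).
  apply: filterS FV => v Vv; apply/esym.
  exact: (coded_ball_coord (UV (u, v) (conj Uu Vv))).
have [b Fb] := choice Fn.
have FN N : F [set x | forall n, (n < N)%N -> code c n x = b n].
  elim: N => [|N IH]; first by apply: filterS filterT => x.
  apply: filterS2 IH (Fb N) => x xN xb n.
  by rewrite ltnS leq_eqVlt => /orP[/eqP->//|/xN].
have [x xb] : exists x, forall n, code c n x = b n.
  by apply: code_closed => N; have [x] := filter_ex (FN N); exists x.
apply/cvg_ex; exists x; apply/fcvg_ballP => e e0.
have [N Ne] := coded_ball_prefix e0.
by apply: filterS (FN N) => y yb; apply: Ne => n nN; rewrite xb yb.
Qed.

HB.instance Definition _ :=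
  Uniform_isComplete.Build (coded_space R c) coded_complete.

Definition prefix_set (l : seq B) : set T :=
  [set x | [seq code c n x | n <- iota 0 (size l)] = l].

Lemma prefix_setP x N y : prefix_set [seq code c n x | n <- iota 0 N] y <->
  forall n, (n < N)%N -> code c n y = code c n x.
Proof.
rewrite /prefix_set /= size_map size_iota; split; last first.
  by move=> yx; apply/eq_in_map => n; rewrite mem_iota add0n => /yx.
by move=> /eq_in_map yx n nN; apply: yx; rewrite mem_iota.
Qed.

Lemma open_codeP (U : set (coded_space R c)) : open U <->
  forall x, U x -> exists N, prefix_set [seq code c n x | n <- iota 0 N] `<=` U.
Proof.
rewrite openE; split => [oU x Ux|oU x Ux].
  have /nbhs_ballP[e e0 eU] := oU _ Ux.
  have [N Ne] := coded_ball_prefix e0.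
  by exists N => y /prefix_setP yx; apply: eU; apply: Ne => n /yx.
have [N NU] := oU _ Ux; apply/nbhs_ballP; exists N.+1%:R^-1 => /=.
  by rewrite invr_gt0.
move=> y xy; apply: NU; apply/prefix_setP => n nN.
by apply/esym; apply: (coded_ball_coord xy); exact: ltnW.
Qed.

Lemma coded_hausdorff : hausdorff_space (coded_space R c).
Proof.
rewrite ball_hausdorff => a b ab.
have [n nab] : exists n, code c n a <> code c n b.
  by apply/existsNP => h; move/eqP: ab; apply; exact: code_inj.
have n0 : 0 < n.+1%:R^-1 :> R by rewrite invr_gt0.
exists (PosNum n0, PosNum n0); apply/eqP/seteqP; split => // y /= [ay bY].
by apply: nab; rewrite (coded_ball_coord ay)// (coded_ball_coord bY).
Qed.

(** There are countably many finite prefixes; one point is chosen in each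
    prefix set that is not empty. *)
Lemma coded_separable : exists2 D : set (coded_space R c), countable D & dense D.
Proof.
exists ((fun l => xget point (prefix_set l)) @` [set: seq B]).
  exact: sub_countable (card_image_le _ _) (countableP _).
move=> U [x Ux] /open_codeP/(_ _ Ux)[N NU].
set l := [seq _ | _ <- _] in NU; exists (xget point (prefix_set l)); split.
  by apply: NU; apply: (@xgetPex _ point (prefix_set l)); exists x; apply/prefix_setP.
by exists l.
Qed.

Lemma prefix_sigma l : <<s site_events (code c) setT >> (prefix_set l).
Proof.
have [->|/set0P[x lx]] := eqVneq (prefix_set l) set0; first exact: sigma_algebra0.
have -> : prefix_set l = cyl (code c) (iota 0 (size l)) (code c ^~ x).
  rewrite -{1}lx; apply/seteqP; split => y.
    by move=> /prefix_setP yx n; rewrite mem_iota => /yx.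
  by move=> yx; apply/prefix_setP => n nl; apply: yx; rewrite mem_iota.
exact: cyl_sigma.
Qed.

(** An open set is the union of the prefix sets that it contains, and there are
    only countably many of them. *)
Lemma coded_borel :
  <<s @open (coded_space R c) >> = <<s site_events (code c) setT >>.
Proof.
apply/seteqP; split; apply: smallest_sub; try exact: smallest_sigma_algebra.
- move=> U oU.
  have -> : U = \bigcup_(l in [set l | prefix_set l `<=` U]) prefix_set l.
    apply/seteqP; split => [x Ux|x [l lU /lU//]].
    have [N NU] := (open_codeP U).1 oU x Ux.
    by exists [seq code c n x | n <- iota 0 N] => //; apply/prefix_setP.
  rewrite bigcup_mkcond.
  apply: (@countable_bigcupT_measurable _ (g_sigma_algebraType _)) => [|l].
    exact: countableP.
  by case: ifPn => _; [exact: prefix_sigma|exact: sigma_algebra0].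
- move=> E [n [b [_ ->]]]; apply: sub_sigma_algebra; apply/open_codeP => x xb.
  by exists n.+1 => y /prefix_setP /= ->.
Qed.

End Coding.

Lemma polish_coding (R : realType) (d : measure_display) (T : measurableType d)
    (B : countType) (c : coding T B) :
  @measurable d T = <<s site_events (code c) setT >> -> polish R T.
Proof.
move=> mT; exists (coded_space R c), id; split.
- exact: coded_hausdorff.
- exact: coded_separable.
- by exists id.
- rewrite mT coded_borel preimage_set_system_id.
  apply/seteqP; split=> [E sE|_ [E sE <-]]; last by rewrite setTI.
  by exists E; rewrite ?setTI.
Qed.

(** * The configuration spaces are Polish *)

(** Enumerating the sites by pickling may repeat some of them; a sequence of
    values is then realisable only if it is constant on the repetitions, which
    follows from the realisability of its prefixes. *)
Lemma polish_coordinates (R : realType) (d : measure_display)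
    (T : measurableType d) (I B : countType) (i0 : I) (Y : I -> T -> B) :
  (forall x y, (forall i, Y i x = Y i y) -> x = y) ->
  (forall f, exists x, forall i, Y i x = f i) ->
  @measurable d T = <<s site_events Y setT >> -> polish R T.
Proof.
move=> injY surjY mT.
pose dec n := odflt i0 (unpickle n).
have decK i : dec (pickle i) = i by rewrite /dec pickleK.
have inj x y : (forall n, Y (dec n) x = Y (dec n) y) -> x = y.
  by move=> xy; apply: injY => i; rewrite -(decK i).
have closed (b : nat -> B) :
    (forall N, exists x, forall n, (n < N)%N -> Y (dec n) x = b n) ->
    exists x, forall n, Y (dec n) x = b n.
  move=> bP; have [x xb] := surjY (b \o pickle); exists x => n.
  (* A prefix long enough to contain n and the standard number of its site. *)
  have [y yb] := bP (maxn n (pickle (dec n))).+1.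
  rewrite xb /= -!yb ?decK// ltnS ?leq_maxl//.
  exact: leq_maxr.
apply: (@polish_coding _ _ _ _ (Coding inj closed)).
rewrite mT /=; congr (<<s _ >>); apply/seteqP; split => _ [i [b [_ ->]]].
  by exists (pickle i), b; rewrite decK.
by exists (dec i), b.
Qed.

Lemma sigma_setI (T : pointedType) (C : set_system T) E F :
  <<s C >> E -> <<s C >> F -> <<s C >> (E `&` F).
Proof. exact: (@measurableI _ (g_sigma_algebraType C)). Qed.

Section CoordinateSpaces.
Context (R : realType).
Variable A : finZmodType.

Definition site (z : int * int) (x : path_space A) : A := x z.1 z.2.

Lemma measurable_coord (I : Type) (d : measure_display) (T : I -> measurableType d)
    (i : I) (E : set (T i)) : measurable E ->
  measurable ((fun x : prod_space T => x i) @^-1` E).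
Proof.
move=> mE; apply: sub_sigma_algebra; exists i => //; exists E => //.
by rewrite setTI.
Qed.

Lemma measurable_site z a : measurable (site z @^-1` [set a]).
Proof.
apply: (@measurable_coord _ _ _ z.1 ((fun x : row_space A => x z.2) @^-1` [set a])).
exact: (@measurable_coord _ _ (fun=> discrete A)).
Qed.

Lemma measurable_path_space :
  @measurable _ (path_space A) = <<s site_events site setT >>.
Proof.
apply/seteqP; split; last exact: (@site_events_measurable _ (path_space A) _ A _ measurable_site).
apply: smallest_sub; first exact: smallest_sigma_algebra.
move=> _ [n _ [B mB <-]]; rewrite setTI.
apply: (@preimage_row_sigma _ _ (path_space A) _ (fun x => x n)) => //.
by move=> i a; apply: sub_sigma_algebra; exists (n, i), a.
Qed.

Lemma polish_path_space : polish R (path_space A).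
Proof.
apply: (@polish_coordinates _ _ _ _ _ (0, 0) site).
- by move=> x y xy; apply/funext => n; apply/funext => i; exact: (xy (n, i)).
- by move=> f; exists (fun n i => f (n, i)) => -[n i].
- exact: measurable_path_space.
Qed.

Lemma polish_discrete : polish R (discrete A).
Proof.
apply: (@polish_coordinates _ _ _ unit _ tt (fun _ (a : discrete A) => a : A)).
- by move=> x y; exact.
- by move=> f; exists (f tt) => -[].
- apply/seteqP; split => // E _.
  have -> : E = \bigcup_(a in E) [set a] by rewrite bigcup_imset1 image_id.
  apply: (@fin_bigcup_measurable _ (g_sigma_algebraType _)).
    exact: (@finite_finset A).
  by move=> a _; apply: sub_sigma_algebra; exists tt, a.
Qed.

End CoordinateSpaces.

Section ProductSpaces.
Context (R : realType) (A A' : finZmodType).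

Definition pair_site (z : int * int) (w : path_space A * path_space A') : A * A' :=
  (site z w.1, site z w.2).

Lemma measurable_pair_site z c : measurable (pair_site z @^-1` [set c]).
Proof.
have -> : pair_site z @^-1` [set c] =
    (site z @^-1` [set c.1]) `*` (site z @^-1` [set c.2]).
  by apply/seteqP; split=> w /=; case: c => a b /=; [case|case=> <- <-].
by apply: measurableX; exact: measurable_site.
Qed.

Lemma measurable_pair_space :
  @measurable _ (path_space A * path_space A')%type =
  <<s site_events pair_site setT >>.
Proof.
apply/seteqP; split; last exact: (@site_events_measurable _
  (path_space A * path_space A')%type _ (A * A')%type _ measurable_pair_site).
rewrite measurable_prod_measurableType.
apply: smallest_sub; first exact: smallest_sigma_algebra.
move=> _ [E mE [F mF <-]].
have -> : E `*` F = (fst @^-1` E) `&` (snd @^-1` F) by [].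
rewrite measurable_path_space in mE; rewrite measurable_path_space in mF.
apply: sigma_setI.
  move: mE; apply: preimage_sigma_sub; first exact: smallest_sigma_algebra.
  move=> _ [z [a [_ ->]]].
  have -> : fst @^-1` (site z @^-1` [set a]) =
      \bigcup_(b in [set: A']) (pair_site z @^-1` [set (a, b)]).
    apply/seteqP; split => w /=; first by move=> wa; exists (site z w.2); rewrite // /pair_site /= wa.
    by case=> b _ [].
  apply: (@fin_bigcup_measurable _ (g_sigma_algebraType _)).
    exact: finite_finset.
  by move=> b _; apply: sub_sigma_algebra; exists z, (a, b).
move: mF; apply: preimage_sigma_sub; first exact: smallest_sigma_algebra.
move=> _ [z [b [_ ->]]].
have -> : snd @^-1` (site z @^-1` [set b]) =
    \bigcup_(a in [set: A]) (pair_site z @^-1` [set (a, b)]).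
  apply/seteqP; split => w /=; first by move=> wa; exists (site z w.1); rewrite // /pair_site /= wa.
  by case=> a _ [].
apply: (@fin_bigcup_measurable _ (g_sigma_algebraType _)).
  exact: finite_finset.
by move=> a _; apply: sub_sigma_algebra; exists z, (a, b).
Qed.

Lemma polish_pair_space : polish R (path_space A * path_space A')%type.
Proof.
apply: (@polish_coordinates _ _ _ _ _ (0, 0) pair_site).
- move=> [x x'] [y y'] xy; congr (_, _); apply/funext => n; apply/funext => i.
    by have [] := xy (n, i).
  by have [] := xy (n, i).
- move=> f; exists ((fun n i => (f (n, i)).1), (fun n i => (f (n, i)).2)).
  by case=> n i; rewrite /pair_site /site /=; case: (f (n, i)).
- exact: measurable_pair_space.
Qed.

End ProductSpaces.

(** * The law of the chain is invariant under the shift of the rows *)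

Section RowShift.
Context (A : finZmodType).

Lemma path_measurable_fun (d : measure_display) (Omega : measurableType d)
    (f : Omega -> path_space A) :
  (forall z a, measurable ((fun w => site z (f w)) @^-1` [set a])) ->
  measurable_fun setT f.
Proof.
move=> mf _ E mE; rewrite setTI; rewrite measurable_path_space in mE.
move: mE; apply: preimage_sigma_sub; first exact: sigma_algebra_measurable.
by move=> _ [z [a [_ ->]]]; exact: mf.
Qed.

Lemma measurable_row_shift : measurable_fun setT (fwd (row_shift A)).
Proof.
apply: path_measurable_fun => z a.
exact: (measurable_site (z.1, z.2 + 1)).
Qed.

Lemma measurable_row_shift_bwd : measurable_fun setT (bwd (row_shift A)).
Proof.
apply: path_measurable_fun => z a.
exact: (measurable_site (z.1, z.2 - 1)).
Qed.

Definition shift_site (z : int * int) : int * int := (z.1, z.2 + 1).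

Lemma row_shift_cyl t (a : int * int -> A) :
  row_shift A @^-1` cyl (@site A) t a =
  cyl (@site A) (map shift_site t) (fun z => a (z.1, z.2 - 1)).
Proof.
apply/seteqP; split => w h z.
  by move=> /mapP[[m i] yt ->]; rewrite /= addrK -h.
by move=> zt; have := h _ (map_f shift_site zt); rewrite /= addrK; case: z zt.
Qed.

End RowShift.

(** The sites of the rows n, ..., n + k on which the row s at time n + k
    depends: each site looks at itself and at its right neighbour one step
    earlier.  On such sets the law of the chain is explicit, and they are
    cofinal among the finite sets of sites. *)
Fixpoint light_cone (n : int) (s : seq int) (k : nat) : seq (int * int) :=
  if k is k'.+1 then
    [seq (n + k%:Z, i) | i <- s] ++
    light_cone n (s ++ [seq i + 1 | i <- s]) k'
  else [seq (n, i) | i <- s].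

Lemma light_cone_rows n s k z : z \in light_cone n s k -> z.1 <= n + k%:Z.
Proof.
elim: k s => [|k IHk] s /=; first by move=> /mapP[i _ ->]; rewrite addr0.
rewrite mem_cat => /orP[/mapP[i _ ->]//|/IHk /le_trans]; apply.
by rewrite lerD2l lez_nat.
Qed.

Lemma light_cone_contains n s k j i :
  i \in s -> (j <= k)%N -> (n + j%:Z, i) \in light_cone n s k.
Proof.
elim: k s => [|k IHk] s si /=.
  by rewrite leqn0 => /eqP->; rewrite addr0; exact: map_f.
rewrite leq_eqVlt mem_cat => /orP[/eqP->|jk]; first by rewrite map_f.
by rewrite IHk ?orbT// mem_cat si.
Qed.

Lemma sub_light_cone (t : seq (int * int)) :
  exists n s k, {subset t <= light_cone n s k}.
Proof.
pose N := (\sum_(z <- t) `|z.1|)%N.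
exists (- N%:Z), [seq z.2 | z <- t], (N + N)%N => -[m i] ti.
have mN : (`|m| <= N)%N.
  by rewrite /N (big_rem _ ti) /= leq_addr.
have mE : m = - N%:Z + (absz (m + N%:Z))%:Z by lia.
rewrite mE; apply: light_cone_contains; first by apply/mapP; exists (m, i).
by lia.
Qed.

Section ChainLaw.
Context (R : realType) (A : finZmodType) (eps : R).
Variables (P : probability (path_space A) R) (mu nu : probability (row_space A) R).
Hypothesis hmu : iid_law (uniform_pmf R (A := A)) mu.
Hypothesis hnu : iid_law (noise_pmf eps (A := A)) nu.
Hypothesis hP : stationary_chain mu (tau_kernel nu) P.

Definition past (n : int) : set_system (path_space A) :=
  <<s site_events (@site A) [set z | z.1 <= n] >>.

Lemma past_measurable n : past n `<=` measurable.
Proof. exact: (@site_events_measurable _ (path_space A) _ A _ (@measurable_site A)). Qed.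

Definition row_cyl (s : seq int) (a : int -> A) : set (row_space A) :=
  [set y | forall i, i \in s -> y i = a i].

Lemma measurable_row_cyl s a : measurable (row_cyl s a).
Proof.
apply: (@cyl_measurable _ (row_space A) _ A (fun i (y : row_space A) => y i)).
by move=> i b; exact: (@measurable_coord _ _ (fun=> discrete A)).
Qed.

Lemma chain_row_law n s a : uniq s ->
  P (chain_row n @^-1` row_cyl s a) = (#|A|%:R^-1 ^+ size s)%:E.
Proof.
move=> us; have [-> _] := hP n (measurable_row_cyl s a).
by rewrite hmu// /uniform_pmf big_const_seq count_predT iter_mulr_1.
Qed.

(** On an event that fixes the values of row n at the sites i and i + 1 for all
    i in s, the transition kernel evaluated on a cylinder over s is constant,
    and the integral in the Markov property is a product. *)
Lemma chain_step n s C (x a : int -> A) : uniq s -> past n C ->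
  (forall w, C w -> forall i, i \in s -> w n i = x i /\ w n (i + 1) = x (i + 1)) ->
  P (C `&` chain_row (n + 1) @^-1` row_cyl s a) =
  ((\prod_(i <- s) noise_pmf eps (a i - (x i + x (i + 1))))%:E * P C)%E.
Proof.
move=> us nC Cx; have [_ ->] := hP n (measurable_row_cyl s a); last first.
  by rewrite Sigma_rows; exact: sigma_null_completion.
rewrite (eq_integral (fun=> (\prod_(i <- s) noise_pmf eps (a i - (x i + x (i + 1))))%:E)).
  by rewrite integral_cst//; exact: past_measurable nC.
move=> w /set_mem Cw; rewrite -(hnu (fun i => a i - (x i + x (i + 1))) us).
rewrite /tau_kernel /pushforward; congr (nu _).
apply/seteqP; split => xi /= h i si; have [xi1 xi2] := Cx w Cw i si.
  by rewrite -(h i si) /tau /chain_row xi1 xi2 addrC addKr.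
by rewrite (h i si) /tau /chain_row xi1 xi2 addrC subrK.
Qed.

Lemma past_cyl n s a :
  (forall z, z \in s -> z.1 <= n) -> past n (cyl (@site A) s a).
Proof. exact: cyl_sigma. Qed.

(** By induction on the height of the cone: [chain_step] removes its top row,
    and the weights that it produces are the same for the cone and for its
    translate. *)
Lemma shift_light_cone n s k (a : int * int -> A) :
  P (row_shift A @^-1` cyl (@site A) (light_cone n s k) a) =
  P (cyl (@site A) (light_cone n s k) a).
Proof.
pose a' (z : int * int) := a (z.1, z.2 - 1).
pose sh := shift_site.
have shE t := row_shift_cyl t a.
have rowE (b : int * int -> A) m t :
    cyl (@site A) [seq (m, i) | i <- t] b =
    chain_row m @^-1` row_cyl (undup t) (fun i => b (m, i)).
  apply/seteqP; split => w h.
    by move=> i; rewrite mem_undup => ti; exact: (h _ (map_f _ ti)).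
  by move=> z /mapP[i ti ->]; apply: h; rewrite mem_undup.
have sh_row m t : map sh [seq (m, i) | i <- t] = [seq (m, i) | i <- [seq i + 1 | i <- t]].
  by rewrite -!map_comp.
have size_sh t : size (undup [seq i + 1 | i <- t] : seq int) = size (undup t).
  by rewrite undup_map_inj ?size_map//; exact: addIr.
elim: k s => [|k IHk] s /=.
  by rewrite shE sh_row !rowE !chain_row_law ?undup_uniq// size_sh.
rewrite shE map_cat !cyl_cat sh_row !rowE -shE.
set t := s ++ _; set C := cyl _ (light_cone n t k) a.
have Cn : past (n + k%:Z) C by apply: past_cyl => z /light_cone_rows.
have C'n : past (n + k%:Z) (row_shift A @^-1` C).
  rewrite shE; apply: past_cyl => z /mapP[y /light_cone_rows yk ->].
  exact: yk.
have nk : n + k.+1%:Z = n + k%:Z + 1 by rewrite -addrA -PoszD addn1.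
have top i : i \in s ->
    (n + k%:Z, i) \in light_cone n t k /\ (n + k%:Z, i + 1) \in light_cone n t k.
  move=> si; split; apply: light_cone_contains => //; rewrite mem_cat ?si//.
  by rewrite (map_f (fun i => i + 1) si) orbT.
rewrite !(setIC (chain_row _ @^-1` _)) nk.
rewrite (@chain_step _ _ _ (fun i => a' (n + k%:Z, i))) ?undup_uniq//; last first.
  move=> w Cw i; rewrite mem_undup => /mapP[j /top[t1 t2] ->].
  by rewrite /a' /= !addrK -(Cw _ t1) -(Cw _ t2).
rewrite (@chain_step _ _ _ (fun i => a (n + k%:Z, i))) ?undup_uniq//; last first.
  by move=> w Cw i; rewrite mem_undup => /top[t1 t2]; rewrite -(Cw _ t1) -(Cw _ t2).
rewrite IHk undup_map_inj ?big_map; last exact: addIr.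
by congr (_%:E * _)%E; apply: eq_bigr => i _; rewrite /a' /= !addrK.
Qed.

Lemma row_shift_preserving E : measurable E -> P (row_shift A @^-1` E) = P E.
Proof.
have mS := @measurable_row_shift A.
rewrite measurable_path_space.
apply: (@cyl_unique R _ (path_space A) _ A (@site A) (@measurable_site A) setT
  (pushforward P (fwd (row_shift A))) P).
  by rewrite /= /pushforward preimage_setT probability_setT ltry.
move=> t a _ _; have [n [s [k tC]]] := sub_light_cone t.
apply: (@cyl_sub_eq R _ (path_space A) _ A (@site A) (@measurable_site A)
  (pushforward P (fwd (row_shift A))) P _ _ tC) => b.
exact: shift_light_cone.
Qed.

End ChainLaw.

(** * Existence of a Bernoulli field *)

Definition bernoulli_weight (R : realType) (beta : R) (b : bool) : R :=
  if b then beta else 1 - beta.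

(** A product formula on a set of sites passes to its subsets, by summation
    over the values at one site after the other. *)
Lemma bernoulli_marginal (R : realType) (d : measure_display)
    (Omega : measurableType d) (I : eqType) (Y : I -> Omega -> bool) (beta : R)
    (m : {measure set Omega -> \bar R}) (t s : seq I) :
  (forall i b, measurable (Y i @^-1` [set b])) ->
  uniq (t ++ s) ->
  (forall a, m (cyl Y (t ++ s) a) =
             (\prod_(i <- t ++ s) bernoulli_weight beta (a i))%:E) ->
  forall a, m (cyl Y s a) = (\prod_(i <- s) bernoulli_weight beta (a i))%:E.
Proof.
move=> mY; elim: t => [//|z t IHt] /= /andP[zts uts] mE a.
apply: IHt => // b; have mC := cyl_measurable mY (t ++ s) b.
pose part c := cyl Y (t ++ s) b `&` (Y z @^-1` [set c]).
have -> : cyl Y (t ++ s) b = part true `|` part false.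
  by rewrite -setIUr -preimage_setU -setT_bool preimage_setT setIT.
have -> : m (part true `|` part false) = (m (part true) + m (part false))%E.
  apply: measureU; [exact: measurableI|exact: measurableI|].
  by apply/seteqP; split => // w [[_ /= wt] [_ /= wf]]; rewrite wt in wf.
have key c : m (part c) =
    (bernoulli_weight beta c * \prod_(i <- t ++ s) bernoulli_weight beta (b i))%:E.
  have bE i : i \in t ++ s -> (if i == z then c else b i) = b i.
    by move=> its; case: eqP => // iz; rewrite -iz its in zts.
  have := mE (fun i => if i == z then c else b i).
  rewrite cyl_cons big_cons eqxx (eq_cyl _ bE) /part setIC => ->.
  by congr (_ * _)%:E; apply: eq_big_seq => i /bE ->.
by rewrite !key -EFinD -mulrDl /bernoulli_weight addrC subrK mul1r.
Qed.

Section BernoulliDigits.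
Context (R : realType) (beta : R).
Hypothesis beta01 : 0 <= beta <= 1.

(** A cell (a, l) stands for the interval [a, a + l[; it is cut into a left
    part of relative length beta, with digit true, and a right part with digit
    false.  The digits of a uniform variable with respect to these successive
    subdivisions are independent Bernoulli variables. *)
Definition subcell (c : R * R) (b : bool) : R * R :=
  if b then (c.1, c.2 * beta) else (c.1 + c.2 * beta, c.2 * (1 - beta)).

Definition low_digit (c : R * R) (u : R) : bool := u < c.1 + c.2 * beta.

Fixpoint cell_of (n : nat) (u : R) : R * R :=
  if n is m.+1 then subcell (cell_of m u) (low_digit (cell_of m u) u) else (0, 1).

Definition digit (n : nat) (u : R) : bool := low_digit (cell_of n u) u.

Fixpoint cell (b : nat -> bool) (n : nat) : R * R :=
  if n is m.+1 then subcell (cell b m) (b m) else (0, 1).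

(** The cell of a point depends only on its previous digits, so that a
    prescription of the first digits is a single interval ([digit_cell]). *)
Lemma cell_ofE b n u :
  (forall k, (k < n)%N -> digit k u = b k) -> cell_of n u = cell b n.
Proof.
elim: n => [//|n IHn] ub /=; rewrite -(ub n)// /digit IHn// => k kn.
by apply: ub; exact: ltnW.
Qed.

Lemma cell_length b n : (cell b n).2 = \prod_(k <- iota 0 n) bernoulli_weight beta (b k).
Proof.
elim: n => [|n IHn]; first by rewrite big_nil.
rewrite -addn1 iotaD big_cat big_seq1 addn1 /= -IHn /subcell add0n.
by case: (b n).
Qed.

Lemma bernoulli_weight_ge0 b : 0 <= bernoulli_weight beta b.
Proof. by case: b; rewrite /bernoulli_weight ?subr_ge0; case/andP: beta01. Qed.

Lemma cell_length_ge0 b n : 0 <= (cell b n).2.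
Proof. by rewrite cell_length prodr_ge0// => k _; exact: bernoulli_weight_ge0. Qed.

Lemma digit_cell b n :
  [set` `[0, 1[] `&` cyl digit (iota 0 n) b =
  [set` `[(cell b n).1, (cell b n).1 + (cell b n).2[].
Proof.
have [b0 b1] := andP beta01.
elim: n => [|n IHn]; first by rewrite cyl_nil setIT /= add0r.
rewrite -addn1 iotaD cyl_cat setIA IHn add0n cyl_cons cyl_nil setIT.
have L0 := cell_length_ge0 b n; rewrite addn1.
have -> : [set` `[(cell b n).1, (cell b n).1 + (cell b n).2[] `&`
          digit n @^-1` [set b n] =
          [set` `[(cell b n).1, (cell b n).1 + (cell b n).2[] `&`
          [set u | low_digit (cell b n) u = b n].
  rewrite -IHn; apply/seteqP; split => u /= [[u01 ub] ubn]; split => //.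
    by rewrite -(@cell_ofE b n u)// => k kn; apply: ub; rewrite mem_iota.
  by rewrite /digit (@cell_ofE b n u)// => k kn; apply: ub; rewrite mem_iota.
move: L0; rewrite /= /subcell /low_digit; move: (cell b n) => [lo len] /= L0.
apply/seteqP; split => u /=; case: (b n) => /=; rewrite !in_itv /=.
- by move=> [/andP[-> _] ->].
- move=> [/andP[_ u1] /negbT]; rewrite -leNgt => ->.
  by rewrite -addrA -mulrDr addrCA subrr addr0 mulr1.
- move=> /andP[u0 u1]; rewrite u0 u1; split => //; apply: lt_le_trans u1 _.
  by rewrite lerD2l ler_piMr.
- move=> /andP[u0]; rewrite -addrA -mulrDr addrCA subrr addr0 mulr1 => ->.
  rewrite andbT; split; last by apply/negbTE; rewrite -leNgt.
  by apply: le_trans u0; rewrite lerDl mulr_ge0.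
Qed.

Lemma measurable_cell_of n : measurable_fun setT (fun u => (cell_of n u).1) /\
  measurable_fun setT (fun u => (cell_of n u).2).
Proof.
elim: n => [|n [m1 m2]] /=; first by split; exact: measurable_cst.
have md : measurable_fun setT (fun u => low_digit (cell_of n u) u).
  apply: measurable_fun_ltr => //; apply: measurable_funD => //.
  by apply: measurable_funM => //; exact: measurable_cst.
split.
  rewrite (_ : (fun u => _) = fun u => if low_digit (cell_of n u) u
      then (cell_of n u).1 else (cell_of n u).1 + (cell_of n u).2 * beta).
    apply: measurable_fun_ifT => //; apply: measurable_funD => //.
    by apply: measurable_funM => //; exact: measurable_cst.
  by apply/funext => u; rewrite /subcell; case: ifP.
rewrite (_ : (fun u => _) = fun u => if low_digit (cell_of n u) u
    then (cell_of n u).2 * beta else (cell_of n u).2 * (1 - beta)).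
  by apply: measurable_fun_ifT => //; apply: measurable_funM => //; exact: measurable_cst.
by apply/funext => u; rewrite /subcell; case: ifP.
Qed.

Lemma measurable_digit n b : measurable (digit n @^-1` [set b] : set R).
Proof.
have [m1 m2] := measurable_cell_of n.
have md : measurable_fun setT (digit n).
  apply: measurable_fun_ltr => //; apply: measurable_funD => //.
  by apply: measurable_funM => //; exact: measurable_cst.
by rewrite -[X in measurable X]setTI; exact: md.
Qed.

Let mI : measurable ([set` `[0, 1[] : set R) := measurable_itv _.
Let unif := mrestr (@lebesgue_measure R) mI.

HB.instance Definition _ := Measure.on unif.

(** On an initial segment of digits this is the length of a cell; any other
    finite set of digits is a subset of an initial segment. *)
Lemma digit_law s b : uniq s ->
  unif (cyl digit s b) = (\prod_(k <- s) bernoulli_weight beta (b k))%:E.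
Proof.
move=> us; pose N := (\sum_(k <- s) k).+1.
have sN k : k \in s -> (k < N)%N.
  by move=> sk; rewrite /N ltnS (big_rem _ sk) /= leq_addr.
pose t := [seq k <- iota 0 N | k \notin s].
have ts : perm_eq (t ++ s) (iota 0 N).
  apply: uniq_perm; last 2 first.
  - exact: iota_uniq.
  - move=> k; rewrite mem_cat mem_filter mem_iota add0n /=.
    by have [/sN->|] := boolP (k \in s); rewrite ?orbT ?orbF.
  rewrite cat_uniq filter_uniq ?iota_uniq//= us andbT; apply/hasPn => k sk.
  by rewrite mem_filter negb_and negbK sk.
apply: (@bernoulli_marginal R _ (measurableTypeR R) _ digit beta unif t s measurable_digit).
  by rewrite (perm_uniq ts) iota_uniq.
move=> a; rewrite (perm_big _ ts) (eq_mem_cyl _ _ (perm_mem ts)).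
transitivity (lebesgue_measure
  ([set` `[(cell a N).1, (cell a N).1 + (cell a N).2[] : set R)).
  by rewrite -digit_cell setIC.
rewrite -cell_length lebesgue_measure_itv [_.1]/= [_.2]/= lte_fin ltrDl.
(* A cell of nonpositive length has length 0. *)
rewrite -EFinD addrC addKr; case: ltP => // L0.
by have := cell_length_ge0 a N; rewrite le_eqVlt ltNge L0 orbF => /eqP<-.
Qed.

Definition digit_path (u : R) : path_space bool :=
  fun n i => digit (pickle (n, i)) u.

Lemma measurable_digit_path : measurable_fun setT digit_path.
Proof. by apply: path_measurable_fun => z b; exact: measurable_digit. Qed.

Definition bernoulli_prob : set (path_space bool) -> \bar R :=
  pushforward unif digit_path.

Let bernoulli0 : bernoulli_prob set0 = 0%E.
Proof. by rewrite /bernoulli_prob /pushforward preimage_set0 measure0. Qed.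

Let bernoulli_ge0 A : (0 <= bernoulli_prob A)%E.
Proof. exact: (measure_ge0 (unif : {measure set (measurableTypeR R) -> \bar R})). Qed.

Let bernoulli_sigma_additive : semi_sigma_additive bernoulli_prob.
Proof.
have mp := measurable_digit_path.
exact: (@measure_semi_sigma_additive _ _ _ (pushforward unif digit_path)).
Qed.

HB.instance Definition _ := isMeasure.Build _ _ _ bernoulli_prob
  bernoulli0 bernoulli_ge0 bernoulli_sigma_additive.

Lemma bernoulli_probT : bernoulli_prob setT = 1%E.
Proof.
rewrite /bernoulli_prob /= /pushforward preimage_setT /unif /mrestr setTI.
by rewrite lebesgue_measure_itv /= lte01 oppr0 adde0.
Qed.

HB.instance Definition _ :=
  Measure_isProbability.Build _ _ _ bernoulli_prob bernoulli_probT.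

Lemma bernoulli_prob_cyl s a : uniq s ->
  bernoulli_prob (cyl (@site bool) s a) =
  (\prod_(z <- s) bernoulli_weight beta (a z))%:E.
Proof.
move=> us; pose dec n : int * int := odflt (0, 0) (unpickle n).
transitivity (unif (cyl digit (map pickle s) (a \o dec))).
  congr (unif _); apply/seteqP; split => u /= h.
    by move=> _ /mapP[[n i] zs ->]; rewrite /= /dec pickleK -(h _ zs).
  move=> [n i] zs; have := h _ (map_f pickle zs).
  by rewrite /= /dec pickleK.
rewrite digit_law; last by rewrite map_inj_uniq//; exact: (pcan_inj pickleK).
by rewrite big_map; congr (_%:E); apply: eq_bigr => z _; rewrite /= /dec pickleK.
Qed.

End BernoulliDigits.

Lemma exists_bernoulli (R : realType) (beta : R) : 0 <= beta <= 1 ->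
  exists Q : probability (path_space bool) R, forall s a, uniq s ->
    Q (cyl (@site bool) s a) = (\prod_(z <- s) bernoulli_weight beta (a z))%:E.
Proof. by move=> beta01; exists (bernoulli_prob beta) => s a; exact: bernoulli_prob_cyl. Qed.

(** * The chain together with an independent Bernoulli field *)

Lemma finite_preimage_sigma (T : pointedType) (G : set_system T) (B : finType)
    (Y : T -> B) : sigma_algebra setT G ->
  (forall b, G (Y @^-1` [set b])) -> forall S, G (Y @^-1` S).
Proof.
move=> sG GY S.
have -> : Y @^-1` S = \bigcup_(b in S) (Y @^-1` [set b]).
  by rewrite -preimage_bigcup bigcup_imset1 image_id.
rewrite -(sigma_algebra_id sG).
apply: (@fin_bigcup_measurable _ (g_sigma_algebraType G)); first exact: finite_finset.
by move=> b _; apply: sub_sigma_algebra.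
Qed.

Notation joint_space A := (path_space A * path_space bool)%type.

Section Joint.
Context (R : realType) (A : finZmodType).
Variables (P : probability (path_space A) R) (Q : probability (path_space bool) R).

Lemma measurable_joint_fst E :
  measurable E -> measurable (fst @^-1` E : set (joint_space A)).
Proof.
by move=> mE; rewrite -[X in measurable X]setTI; exact: measurable_fst.
Qed.

Lemma measurable_joint_snd E :
  measurable E -> measurable (snd @^-1` E : set (joint_space A)).
Proof.
by move=> mE; rewrite -[X in measurable X]setTI; exact: measurable_snd.
Qed.

Definition joint : set (joint_space A) -> \bar R := (P \x Q)%E.

HB.instance Definition _ := Measure.on joint.

Lemma joint_rectangle E F : measurable E -> measurable F ->
  joint (E `*` F) = (P E * Q F)%E.
Proof. exact: product_measure1E. Qed.

Lemma jointT : joint setT = 1%E.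
Proof.
by rewrite -setXTT joint_rectangle// (@probability_setT _ _ _ P)
   (@probability_setT _ _ _ Q) mule1.
Qed.

HB.instance Definition _ := Measure_isProbability.Build _ _ _ joint jointT.

(** Measurable rectangles of events of the two pasts.  They form a pi-system on
    which the product measure is explicit. *)
Definition rectangles (n : int) : set_system (joint_space A) :=
  [set E | exists E1 E2, [/\ @past A n E1, @past bool n E2 & E = E1 `*` E2]].

Definition joint_past (n : int) : set_system (joint_space A) := <<s rectangles n >>.

Lemma past_setT B n : @past B n setT.
Proof. exact: (@measurableT _ (g_sigma_algebraType _)). Qed.

Lemma rectangles_setI n : setI_closed (rectangles n).
Proof.
move=> _ _ [E1 [E2 [nE1 nE2 ->]]] [F1 [F2 [nF1 nF2 ->]]].
by rewrite -setXI; exists (E1 `&` F1), (E2 `&` F2); split => //; exact: sigma_setI.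
Qed.

Lemma rectangles_setT n : rectangles n setT.
Proof.
by exists setT, setT; split; rewrite ?setXTT//; exact: past_setT.
Qed.

Lemma rectangles_measurable n : rectangles n `<=` measurable.
Proof.
move=> _ [E1 [E2 [nE1 nE2 ->]]].
by apply: measurableX; [exact: past_measurable nE1|exact: past_measurable nE2].
Qed.

Lemma joint_past_measurable n : joint_past n `<=` measurable.
Proof.
apply: smallest_sub; first exact: sigma_algebra_measurable.
exact: rectangles_measurable.
Qed.

Lemma joint_past_fst n E : @past A n E -> joint_past n (fst @^-1` E).
Proof.
move=> nE; apply: sub_sigma_algebra; exists E, setT; split => //.
  exact: past_setT.
by apply/seteqP; split => w //= [].
Qed.

Lemma joint_past_snd n E : @past bool n E -> joint_past n (snd @^-1` E).
Proof.
move=> nE; apply: sub_sigma_algebra; exists setT, E; split => //.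
  exact: past_setT.
by apply/seteqP; split => w //= [].
Qed.

(** The first test compares with 0 the noise at (n, i); the second is the value
    of the Bernoulli field. *)
Definition innovation (z : int * int) (w : joint_space A) : option A :=
  let: (n, i) := z in
  if (w.1 n i != w.1 (n - 1) i + w.1 (n - 1) (i + 1)) || w.2 n i
  then Some (w.1 n i) else None.

Lemma joint_past_innovation n z o : z.1 <= n ->
  joint_past n (innovation z @^-1` [set o]).
Proof.
case: z => m i /= mn.
pose Y (w : joint_space A) :=
  ((w.1 m i : A, w.1 (m - 1) i : A), (w.1 (m - 1) (i + 1) : A, w.2 m i : bool)).
(* The innovation is a function g of four coordinates with finitely many
   values. *)
pose g (c : (A * A) * (A * bool)) :=
  if (c.1.1 != c.1.2 + c.2.1) || c.2.2 then Some c.1.1 else None.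
have -> : innovation (m, i) @^-1` [set o] = Y @^-1` (g @^-1` [set o]) by [].
have site_past (B : finZmodType) j k b : j <= n ->
    @past B n ((fun x : path_space B => x j k) @^-1` [set b]).
  by move=> jn; apply: sub_sigma_algebra; exists (j, k), b.
have m1n : m - 1 <= n by rewrite (le_trans _ mn)// gerBl.
apply: finite_preimage_sigma; first exact: smallest_sigma_algebra.
move=> [[a b] [c v]].
have -> : Y @^-1` [set (a, b, (c, v))] =
    fst @^-1` ((fun x : path_space A => x m i) @^-1` [set a]) `&`
    (fst @^-1` ((fun x : path_space A => x (m - 1) i) @^-1` [set b]) `&`
    (fst @^-1` ((fun x : path_space A => x (m - 1) (i + 1)) @^-1` [set c]) `&`
    (snd @^-1` ((fun x : path_space bool => x m i) @^-1` [set v])))).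
  apply/seteqP; split => w; rewrite /Y /=; first by case=> -> -> -> ->.
  by case=> -> [-> [-> ->]].
do ![apply: sigma_setI; first by apply: joint_past_fst; exact: site_past].
by apply: joint_past_snd; exact: site_past.
Qed.

Lemma measurable_innovation z o : measurable (innovation z @^-1` [set o]).
Proof. exact: joint_past_measurable (joint_past_innovation o (lexx z.1)). Qed.

End Joint.

Section BernoulliPast.
Context (R : realType) (beta : R) (Q : probability (path_space bool) R).
Hypothesis hQ : forall s a, uniq s ->
  Q (cyl (@site bool) s a) = (\prod_(z <- s) bernoulli_weight beta (a z))%:E.
Hypothesis beta01 : 0 <= beta <= 1.

Lemma bernoulli_step n s v E : uniq s -> @past bool n E ->
  Q (E `&` chain_row (n + 1) @^-1` row_cyl s v) =
  ((\prod_(i <- s) bernoulli_weight beta (v i))%:E * Q E)%E.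
Proof.
move=> us nE.
have k0 : 0 <= \prod_(i <- s) bernoulli_weight beta (v i).
  by apply: prodr_ge0 => i _; exact: bernoulli_weight_ge0.
have mV : measurable (chain_row (n + 1) @^-1` row_cyl s v : set (path_space bool)).
  exact: (measurable_coord (measurable_row_cyl s v)).
pose m1 := mrestr Q mV; pose m2 := mscale (NngNum k0) Q.
apply: (@cyl_unique R _ (path_space bool) _ bool (@site bool) (@measurable_site bool)
  [set z | z.1 <= n] m1 m2) nE => [|t b tn ut].
  rewrite /m1 /= /mrestr setTI (le_lt_trans (probability_le1 _ _))//.
  by rewrite ltry.
transitivity (Q (cyl (@site bool) (t ++ [seq (n + 1, i) | i <- s])
    (fun z => if z.1 <= n then b z else v z.2))).
  congr (Q _); rewrite cyl_cat; congr (_ `&` _).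
    by apply: eq_cyl => z /tn /= ->.
  apply/seteqP; split => x /= h i.
    by move=> /mapP[j js ->] /=; rewrite gerDl ler10 -(h _ js).
  by move=> js; have := h _ (map_f _ js); rewrite /= gerDl ler10.
rewrite [RHS]/= /mscale /= hQ; last first.
  rewrite cat_uniq ut map_inj_uniq ?us ?andbT; last by move=> i j [].
  apply/hasPn => _ /mapP[i _ ->]; apply/negP => /tn /=.
  by rewrite gerDl ler10.
rewrite hQ// -EFinM mulrC big_cat /= big_map; congr (_ * _)%:E.
  by apply: eq_big_seq => z /tn /= ->.
by apply: eq_bigr => i _; rewrite /= gerDl ler10.
Qed.

End BernoulliPast.

(** * Independence of the innovations *)

Section InnovationLaw.
Context (R : realType) (A : finZmodType) (eps beta : R).
Variables (P : probability (path_space A) R) (Q : probability (path_space bool) R).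
Variables (mu nu : probability (row_space A) R).
Hypothesis A2 : (2 <= #|A|)%N.
Hypothesis eps01 : 0 <= eps <= 1.
Hypothesis beta01 : 0 <= beta <= 1.
Hypothesis eps_beta : (1 - eps) * beta = eps / (#|A|%:R - 1).
Hypothesis hnu : iid_law (noise_pmf eps (A := A)) nu.
Hypothesis hP : stationary_chain mu (tau_kernel nu) P.
Hypothesis hQ : forall s a, uniq s ->
  Q (cyl (@site bool) s a) = (\prod_(z <- s) bernoulli_weight beta (a z))%:E.

Lemma card_A1_gt0 : (0 : R) < #|A|%:R - 1.
Proof. by rewrite subr_gt0 ltr1n. Qed.

Lemma noise_pmf_ge0 (a : A) : 0 <= noise_pmf eps a :> R.
Proof.
have [e0 e1] := andP eps01; rewrite /noise_pmf; case: ifP => _.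
  by rewrite subr_ge0.
by rewrite divr_ge0// ltW// card_A1_gt0.
Qed.

(** Both sides are finite measures in C, and on a rectangle the two factors are
    given by [chain_step] and [bernoulli_step]. *)
Lemma joint_step n (s s' : seq int) C (x a : int -> A) (v : int -> bool) :
  uniq s -> uniq s' -> @joint_past A n C ->
  joint P Q (C `&` fst @^-1` (chain_row n @^-1` row_cyl (s ++ [seq i + 1 | i <- s]) x)
     `&` (fst @^-1` (chain_row (n + 1) @^-1` row_cyl s a) `&`
          snd @^-1` (chain_row (n + 1) @^-1` row_cyl s' v))) =
  ((\prod_(i <- s) noise_pmf eps (a i - (x i + x (i + 1))) *
    \prod_(i <- s') bernoulli_weight beta (v i))%:E *
   joint P Q (C `&`
     fst @^-1` (chain_row n @^-1` row_cyl (s ++ [seq (i + 1)%R | i <- s]) x)))%E.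
Proof.
move=> us us' nC.
set D := chain_row n @^-1` _; set X := chain_row _ @^-1` row_cyl s a.
set V := chain_row _ @^-1` _; set kp := \prod_(i <- s) _; set kq := \prod_(i <- s') _.
have k0 : 0 <= kp * kq.
  rewrite mulr_ge0//; apply: prodr_ge0 => i _; first exact: noise_pmf_ge0.
  exact: bernoulli_weight_ge0.
have nD : @past A n D.
  apply: (@preimage_row_sigma int A (path_space A) (@past A n) (@chain_row A n)).
  - exact: smallest_sigma_algebra.
  - by move=> i b; apply: sub_sigma_algebra; exists (n, i), b; rewrite /= lexx.
  - exact: measurable_row_cyl.
have mD : measurable D by exact: past_measurable nD.
have mX : measurable X by exact: (measurable_coord (measurable_row_cyl s a)).
have mV : measurable V by exact: (measurable_coord (measurable_row_cyl s' v)).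
have mDJ : measurable (fst @^-1` D : set (joint_space A)).
  exact: measurable_joint_fst.
have mK : measurable (fst @^-1` D `&` (fst @^-1` X `&` snd @^-1` V) : set (joint_space A)).
  apply: measurableI => //.
  by apply: measurableI; [exact: measurable_joint_fst|exact: measurable_joint_snd].
pose m1 := mrestr (joint P Q) mK.
pose m2 := mscale (NngNum k0) (mrestr (joint P Q) mDJ).
rewrite -setIA; apply: (@pi_system_unique R _ (joint_space A) (@rectangles A n) m1 m2).
- exact: rectangles_measurable.
- exact: rectangles_setI.
- exact: rectangles_setT.
- rewrite /m1 /= /mrestr setTI (le_lt_trans (probability_le1 _ _))//.
  by rewrite ltry.
- move=> _ [E1 [E2 [nE1 nE2 ->]]].
  have mE1 := past_measurable nE1; have mE2 := past_measurable nE2.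
  transitivity (joint P Q (((E1 `&` D) `&` X) `*` (E2 `&` V))).
    by congr (joint P Q _); apply/seteqP; split => w /=; tauto.
  rewrite [RHS]/= /mscale /= /mrestr.
  rewrite (_ : E1 `*` E2 `&` fst @^-1` D = (E1 `&` D) `*` E2); last first.
    by apply/seteqP; split => w /=; tauto.
  rewrite !joint_rectangle//; try by do ?apply: measurableI.
  rewrite (@chain_step R A eps P mu nu hnu hP n s (E1 `&` D) x a)//; last 2 first.
  - exact: sigma_setI.
  - move=> w [_ Dw] i si; split; apply: Dw; rewrite mem_cat ?si//.
    by rewrite (map_f (fun i => i + 1) si) orbT.
  by rewrite (bernoulli_step hQ beta01)// EFinM muleACA.
- exact: nC.
Qed.

(** These weights do not depend on the past: this is where the choice of beta,
    expressed by eps_beta, enters. *)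
Definition innovation_weight (o : option A) : R :=
  if o is Some _ then eps / (#|A|%:R - 1) else 1 - eps - eps / (#|A|%:R - 1).

Lemma innovation_weightE (o : option A) (t : A) :
  noise_pmf eps (odflt t o - t) *
    (if odflt t o == t then bernoulli_weight beta o else 1) =
  innovation_weight o.
Proof.
rewrite /noise_pmf subr_eq0 /innovation_weight; case: o => [b|] /=.
  by case: eqP => _ /=; rewrite ?mulr1.
by rewrite eqxx /bernoulli_weight /= mulrBr mulr1 eps_beta.
Qed.

Lemma innovation_weight_ge0 o : 0 <= innovation_weight o.
Proof.
rewrite -(innovation_weightE o 0) mulr_ge0//; first exact: noise_pmf_ge0.
by case: ifP => _ //; exact: bernoulli_weight_ge0.
Qed.

(** Given the previous row, an innovation o prescribes the value of the chain,
    and prescribes the Bernoulli variable exactly when the noise vanishes.  So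
    the prescription of finitely many innovations is a single cylinder of the
    pair, with no summation over the noise. *)
Lemma innovationE n i w (o : option A) :
  innovation (n + 1, i) w = o <->
  w.1 (n + 1) i = odflt (w.1 n i + w.1 n (i + 1)) o /\
  (odflt (w.1 n i + w.1 n (i + 1)) o = w.1 n i + w.1 n (i + 1) ->
   w.2 (n + 1) i = o :> bool).
Proof.
rewrite /= addrK; move: (w.1 (n + 1) i) (w.1 n i + w.1 n (i + 1)) (w.2 (n + 1) i) => X t V.
have [->|Xt] /= := eqVneq X t.
  case: V o => -[b|]; split => //=.
  - by case=> ->.
  - by case=> ->.
  - by case=> _ /(_ erefl).
  - by case=> -> /(_ erefl).
case: o => [b|]; split => //=.
- by case=> <-; split => // Xt'; rewrite Xt' eqxx in Xt.
- by case=> ->.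
- by case=> Xt'; rewrite Xt' eqxx in Xt.
Qed.

(** By total probability over the values x of row n at the sites that matter.
    Given these values, the event is the cylinder described by [innovationE],
    and the factors of [joint_step] recombine, site by site, into weights which
    no longer involve x. *)
Lemma innovation_step n s (u : int -> option A) C : uniq s -> @joint_past A n C ->
  joint P Q (C `&` [set w | forall i, i \in s -> innovation (n + 1, i) w = u i]) =
  ((\prod_(i <- s) innovation_weight (u i))%:E * joint P Q C)%E.
Proof.
move=> us nC; have mC := joint_past_measurable nC.
set K := [set w | _]; set k := \prod_(i <- s) _.
have k0 : 0 <= k by apply: prodr_ge0 => i _; exact: innovation_weight_ge0.
have mK : measurable K.
  have -> : K = cyl (fun i (w : joint_space A) => innovation (n + 1, i) w) s u by [].
  apply: (@cyl_measurable _ (joint_space A) _ (option A)) => i b.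
  exact: measurable_innovation.
pose m1 := mrestr (joint P Q) mK; pose m2 := mscale (NngNum k0) (joint P Q).
pose Y (z : int * int) (w : joint_space A) : A := site z w.1.
have mY z b : measurable (Y z @^-1` [set b]).
  exact: (measurable_joint_fst (measurable_site z b)).
apply: (@cyl_total R _ (joint_space A) _ A Y mY m1 m2 C
  [seq (n, i) | i <- s ++ [seq i + 1 | i <- s]]) => // x.
(* t is the row without noise, a the row of the chain that the innovations u
   prescribe, s' the set of sites without noise, and v the value prescribed
   there to the Bernoulli field. *)
pose t i := x (n, i) + x (n, i + 1).
pose a i := odflt (t i) (u i).
pose s' := [seq i <- s | a i == t i].
pose v i : bool := u i.
have -> : cyl Y [seq (n, i) | i <- s ++ [seq i + 1 | i <- s]] x =
    fst @^-1` (chain_row n @^-1` row_cyl (s ++ [seq i + 1 | i <- s]) (fun i => x (n, i))).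
  apply/seteqP; split => w h; first by move=> i si; exact: (h _ (map_f _ si)).
  by move=> _ /mapP[i si ->]; exact: h.
set D := fst @^-1` _.
transitivity (joint P Q (C `&` D `&`
    (fst @^-1` (chain_row (n + 1) @^-1` row_cyl s a) `&`
     snd @^-1` (chain_row (n + 1) @^-1` row_cyl s' v)))).
  congr (joint P Q _); apply/seteqP; split => w [[Cw Dw] Kw]; split => //;
    have tE i : i \in s -> w.1 n i + w.1 n (i + 1) = t i.
  - by move=> si; rewrite /t -!Dw// mem_cat ?si ?(map_f (fun i => i + 1) si) ?orbT.
  - split => i; first by move=> si; have /innovationE[+ _] := Kw i si; rewrite tE.
    rewrite mem_filter => /andP[/eqP ati si].
    by have /innovationE[_] := Kw i si; rewrite tE//; exact.
  - by move=> si; rewrite /t -!Dw// mem_cat ?si ?(map_f (fun i => i + 1) si) ?orbT.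
  - case: Kw => K1 K2 i si; apply/innovationE; rewrite tE//; split; first exact: K1.
    by move=> /eqP ati; apply: K2; rewrite mem_filter ati.
rewrite joint_step//; last exact: filter_uniq.
rewrite [RHS]/= /mscale /=; congr (_%:E * _)%E.
rewrite big_filter (big_mkcond (fun i => a i == t i)) -big_split /=.
by apply: eq_bigr => i _; rewrite innovation_weightE.
Qed.

Definition innovation_row (n : int) : set_system (joint_space A) :=
  site_events (@innovation A) [set z | z.1 = n].

Lemma innovation_independent n C E : @joint_past A n C ->
  <<s innovation_row (n + 1) >> E ->
  joint P Q (C `&` E) = (joint P Q C * joint P Q E)%E.
Proof.
move=> nC nE; have mC := joint_past_measurable nC.
pose k := fine (joint P Q C).
have kE : joint P Q C = k%:E by rewrite fineK// fin_num_measure.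
have k0 : 0 <= k by rewrite -lee_fin -kE measure_ge0.
pose m1 := mrestr (joint P Q) mC; pose m2 := mscale (NngNum k0) (joint P Q).
rewrite kE setIC.
apply: (@cyl_unique R _ (joint_space A) _ (option A) (@innovation A)
  (@measurable_innovation A) [set z | z.1 = n + 1] m1 m2) => // [|s u sn us].
  rewrite /m1 /= /mrestr setTI (le_lt_trans (probability_le1 _ _))//.
  by rewrite ltry.
pose s0 := [seq z.2 | z <- s].
have sE : cyl (@innovation A) s u =
    [set w | forall i, i \in s0 -> innovation (n + 1, i) w = u (n + 1, i)].
  apply/seteqP; split => w h.
    by move=> _ /mapP[[m i] zs ->]; have /= mn := sn _ zs; rewrite -mn; exact: (h (m, i)).
  move=> [m i] zs; have /= -> := sn _ zs; apply: h.
  by apply/mapP; exists (m, i).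
have us0 : uniq s0.
  rewrite map_inj_in_uniq// => -[m i] [m' i'] zs zs' /= ->.
  by have /= -> := sn _ zs; have /= -> := sn _ zs'.
transitivity (joint P Q (C `&` cyl (@innovation A) s u)); first by rewrite setIC.
rewrite [RHS]/= /mscale /= sE innovation_step// -(setTI [set w | _]).
rewrite innovation_step//; last exact: (@measurableT _ (g_sigma_algebraType _)).
by rewrite jointT mule1 muleC kE.
Qed.

End InnovationLaw.

(** * The innovations determine the chain *)

Section Decoding.
Context (A : finZmodType).

Definition innovation_past (n : int) : set_system (joint_space A) :=
  site_events (@innovation A) [set z | z.1 <= n].

Lemma innovation_past_sub n m : n <= m -> innovation_past n `<=` innovation_past m.
Proof. by move=> nm; apply: site_events_sub => z /= zn; exact: le_trans nm. Qed.

Lemma innovation_joint_past n : <<s innovation_past n >> `<=` @joint_past A n.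
Proof.
apply: smallest_sub; first exact: smallest_sigma_algebra.
by move=> _ [z [u [/= zn ->]]]; exact: joint_past_innovation.
Qed.

(** Backward exploration limited to N generations; None means that the limit
    was reached before refreshed sites gave the answer. *)
Fixpoint decode (N : nat) (n i : int) (w : joint_space A) : option A :=
  if N is M.+1 then
    if innovation (n, i) w is Some a then Some a
    else if (decode M (n - 1) i w, decode M (n - 1) (i + 1) w) is (Some b, Some c)
    then Some (b + c) else None
  else None.

Lemma decode_sound N n i w a : decode N n i w = Some a -> w.1 n i = a.
Proof.
elim: N n i a => [//|N IHN] n i a /=.
case: ifP => [_ [] //|/negbT]; rewrite negb_or negbK => /andP[/eqP-> _].
case eb: (decode N (n - 1) i w) => [b|//].
case ec: (decode N (n - 1) (i + 1) w) => [c|//] [<-].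
by rewrite (IHN _ _ _ eb) (IHN _ _ _ ec).
Qed.

Lemma decode_sigma N n i o : <<s innovation_past n >> (decode N n i @^-1` [set o]).
Proof.
elim: N n i o => [|N IHN] n i o.
  case: o => [a|].
    rewrite (_ : _ @^-1` _ = set0); first exact: sigma_algebra0.
    by apply/seteqP; split.
  rewrite (_ : _ @^-1` _ = setT); first exact: (@measurableT _ (g_sigma_algebraType _)).
  by apply/seteqP; split.
pose Y w := (innovation (n, i) w, (decode N (n - 1) i w, decode N (n - 1) (i + 1) w)).
pose g (c : option A * (option A * option A)) :=
  if c.1 is Some a then Some a
  else if c.2 is (Some b, Some c) then Some (b + c) else None.
have -> : decode N.+1 n i @^-1` [set o] = Y @^-1` (g @^-1` [set o]) by [].
apply: finite_preimage_sigma; first exact: smallest_sigma_algebra.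
move=> [a [b c]].
have -> : Y @^-1` [set (a, (b, c))] = innovation (n, i) @^-1` [set a] `&`
    (decode N (n - 1) i @^-1` [set b] `&` decode N (n - 1) (i + 1) @^-1` [set c]).
  apply/seteqP; split => w; rewrite /Y; first by case=> /= -> -> ->.
  by case=> /= -> [-> ->].
have sub : <<s innovation_past (n - 1) >> `<=` <<s innovation_past n >>.
  by apply: sub_sigma_algebra2; apply: innovation_past_sub; rewrite gerBl.
apply: sigma_setI; last by apply: sigma_setI; apply: sub; exact: IHN.
by apply: sub_sigma_algebra; exists (n, i), a; rewrite /= lexx.
Qed.

Lemma measurable_decode N n i o : measurable (decode N n i @^-1` [set o]).
Proof.
apply: (@joint_past_measurable A n); apply: innovation_joint_past.
exact: decode_sigma.
Qed.

End Decoding.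

Section DecodingLaw.
Context (R : realType) (A : finZmodType) (rho : R).
Variable PQ : probability (joint_space A) R.
Hypothesis rho01 : 0 <= rho /\ 2 * rho < 1.
Hypothesis PQ_blank : forall n i C, @joint_past A n C ->
  PQ (C `&` innovation (n + 1, i) @^-1` [set None]) = (rho%:E * PQ C)%E.

(** If the exploration fails at (n, i) then this site is not refreshed, and the
    exploration fails at one of its two parents.  The second event belongs to
    the past, hence is independent of the first, and the bound is multiplied by
    2 rho at each generation. *)
Lemma decode_failure N n i :
  (PQ (decode N n i @^-1` [set None]) <= ((2 * rho) ^+ N)%:E)%E.
Proof.
elim: N n i => [|N IHN] n i; first by rewrite expr0 probability_le1//; exact: measurable_decode.
pose C1 : set (joint_space A) := decode N (n - 1) i @^-1` [set None].
pose C2 : set (joint_space A) := decode N (n - 1) (i + 1) @^-1` [set None].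
have mC1 : measurable C1 by exact: measurable_decode.
have mC2 : measurable C2 by exact: measurable_decode.
have nC : @joint_past A (n - 1) (C1 `|` C2).
  apply: (@measurableU _ (g_sigma_algebraType _));
    exact: (innovation_joint_past (decode_sigma _ _ _ _)).
have mU : measurable (innovation (n, i) @^-1` [set None] : set (joint_space A)).
  exact: measurable_innovation.
apply: (@le_trans _ _ (PQ ((C1 `|` C2) `&` innovation (n, i) @^-1` [set None]))).
  apply: le_measure; rewrite ?inE.
  - exact: measurable_decode.
  - by apply: measurableI => //; exact: measurableU.
  - move=> w /=; rewrite /C1 /C2 /=; case: ifP => // _.
    by case: (decode N (n - 1) i w) => [b|] ; case: (decode N (n - 1) (i + 1) w) => [c|] //;
      move=> _; split => //; [right|left|left].
have := PQ_blank i nC; rewrite subrK => ->.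
have -> : (2 * rho) ^+ N.+1 = rho * ((2 * rho) ^+ N + (2 * rho) ^+ N).
  by rewrite exprS; ring.
rewrite EFinM lee_wpmul2l ?lee_fin ?(proj1 rho01)//.
apply: (@le_trans _ _ (PQ C1 + PQ C2)%E); first exact: measureU2.
by rewrite EFinD leeD// IHN.
Qed.

Lemma never_decoded_null n i :
  null_events PQ (\bigcap_N (decode N n i @^-1` [set None])).
Proof.
pose F N : set (joint_space A) := decode N n i @^-1` [set None].
have mF N : measurable (F N) by exact: measurable_decode.
rewrite -/(\bigcap_N F N); set E := \bigcap_N F N.
have mE : measurable E by exact: bigcapT_measurable.
split=> //.
have [r0 r1] := rho01.
have q0 : 0 <= 2 * rho by rewrite mulr_ge0.
have PE N : fine (PQ E) <= (2 * rho) ^+ N.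
  rewrite -lee_fin fineK ?fin_num_measure//; apply: le_trans (decode_failure N n i).
  apply: le_measure; rewrite ?inE; [exact: mE|exact: mF|].
  by move=> w Ew; exact: Ew.
apply/eqP; rewrite eq_le measure_ge0 andbT -(@fineK _ (PQ E)) ?fin_num_measure// lee_fin.
apply: (@cvgr_to_ge nat \oo _ R (GRing.exp (2 * rho)) 0 (fine (PQ E))).
  by apply: cvg_expr; rewrite ger0_norm.
by near=> N; exact: PE.
Unshelve. all: by end_near. Qed.

(** Decoding is sound, so the event that the site has value a is, outside the
    null event where decoding never succeeds, the event that it is decoded as a
    at some stage. *)
Lemma site_decoded n (z : int * int) a : z.1 <= n ->
  null_completion PQ (@innovation_past A n) ((fun w => site z w.1) @^-1` [set a]).
Proof.
case: z => m i /= mn.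
set E := _ @^-1` _; pose F := \bigcup_N (decode N m i @^-1` [set Some a]).
have mE : measurable E by exact: measurable_joint_fst (measurable_site (m, i) a).
have mU : @innovation_past A n `<=` measurable.
  by move=> _ [z [u [_ ->]]]; exact: measurable_innovation.
have nF : null_completion PQ (@innovation_past A n) F.
  apply: sigma_null_completion; apply: sigma_algebra_bigcup => N.
  have := @decode_sigma A N m i (Some a).
  by apply: sub_sigma_algebra2; exact: innovation_past_sub.
have EF : eq_mod_null PQ E F.
  exists (\bigcap_N (decode N m i @^-1` [set None])); first exact: never_decoded_null.
  apply/seteqP; split => w [Ew Nw]; split => //.
    apply: contrapT => nFw; apply: Nw => N _ /=.
    case e : (decode N m i w) => [b|//]; exfalso; apply: nFw; exists N => //=.
    by rewrite e -(decode_sound e); congr Some.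
  by case: Ew => N _ /decode_sound.
exact: (complete_eq_mod (null_completion_complete PQ mU) mE EF nF).
Qed.

End DecodingLaw.

(** * Conditional probabilities *)

Section Coarsening.
Context (R : realType) (d : measure_display) (Omega : measurableType d).
Variable C : set_system Omega.
Hypotheses (sC : sigma_algebra setT C) (mC : C `<=` measurable).

Local Notation coarse := (g_sigma_algebraType C).

Lemma coarse_measurableE (E : set coarse) : measurable E = C E.
Proof. by rewrite -[in RHS](sigma_algebra_id sC). Qed.

Lemma coarse_id_measurable :
  @measurable_fun _ _ Omega coarse setT (fun w : Omega => w).
Proof. by move=> _ E; rewrite coarse_measurableE setTI => /mC. Qed.

Variable m : {finite_measure set Omega -> \bar R}.

(** The measure m seen on the space Omega endowed with the smaller
    sigma-algebra C.  Densities with respect to it are measurable for C, which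
    makes the Radon-Nikodym theorem a construction of conditional
    probabilities. *)
Definition coarsen : set coarse -> \bar R := m.

Let coarsen0 : coarsen set0 = 0%E. Proof. exact: measure0. Qed.

Let coarsen_ge0 E : (0 <= coarsen E)%E. Proof. exact: measure_ge0. Qed.

Let coarsen_sigma_additive : semi_sigma_additive coarsen.
Proof.
move=> F mF tF mUF.
apply: (@measure_semi_sigma_additive _ Omega R m F) => //.
- by move=> n; have := mF n; rewrite coarse_measurableE => /mC.
- by move: mUF; rewrite coarse_measurableE => /mC.
Qed.

HB.instance Definition _ := isMeasure.Build _ _ _ coarsen
  coarsen0 coarsen_ge0 coarsen_sigma_additive.

Let coarsen_finite : fin_num_fun coarsen.
Proof.
by move=> E; rewrite coarse_measurableE => /mC mE; exact: fin_num_measure.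
Qed.

HB.instance Definition _ := Measure_isFinite.Build _ _ _ coarsen coarsen_finite.

Definition coarse_measure : {finite_measure set coarse -> \bar R} := coarsen.

Lemma integral_coarsen D (h : Omega -> \bar R) : C D ->
  @measurable_fun _ _ coarse (\bar R) setT h -> (forall w, 0 <= h w)%E ->
  (\int[coarsen]_(w in D) h w = \int[m]_(w in D) h w)%E.
Proof.
move=> CD mh h0.
apply: (@ge0_integral_pushforward _ _ Omega coarse R _ coarse_id_measurable m D h).
- by rewrite coarse_measurableE.
- exact: measurable_funTS.
- by move=> w _; exact: h0.
Qed.

End Coarsening.

Lemma ge0_integral_mrestr (R : realType) (d : measure_display)
    (Omega : measurableType d) (m : {measure set Omega -> \bar R}) (E D : set Omega)
    (mE : measurable E) (h : Omega -> \bar R) :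
  measurable D -> measurable_fun setT h -> (forall w, 0 <= h w)%E ->
  (\int[mrestr m mE]_(w in D) h w = \int[m]_(w in E `&` D) h w)%E.
Proof.
move=> mD mh h0.
rewrite (@ge0_negligible_integral _ _ _ (mrestr m mE) D (~` E))//.
- rewrite setDE setCK setIC; apply: eq_measure_integral => F mF FED.
  by rewrite /= /mrestr setIidl// => w /FED[].
- exact: measurableC.
- exact: measurable_funTS.
- by rewrite /= /mrestr setICl measure0.
Qed.

Section ConditionalProbability.
Context (R : realType) (d : measure_display) (Omega : measurableType d).
Variable P : probability Omega R.
Variable C : set_system Omega.
Hypothesis cC : complete_subsigma P C.

Let sC : sigma_algebra setT C. Proof. by case: cC. Qed.
Let mC : C `<=` measurable. Proof. by case: cC. Qed.

Definition measurable_wrt (g : Omega -> R) :=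
  forall B : set R, measurable B -> C (g @^-1` B).

Lemma measurable_wrtP g : measurable_wrt g ->
  @measurable_fun _ _ (g_sigma_algebraType C) R setT g.
Proof. by move=> mg _ B mB; rewrite setTI coarse_measurableE//; exact: mg. Qed.

Lemma measurable_wrtT g : measurable_wrt g -> measurable_fun setT g.
Proof. by move=> mg _ B mB; rewrite setTI; apply: mC; exact: mg. Qed.

(** The function f is the density on C of the measure of the trace on E.  The
    last property is the change of variables for this density; it says that f
    may be replaced by the indicator of E inside integrals of nonnegative
    functions that are measurable for C. *)
Lemma cond_prob_density E : measurable E ->
  exists f : Omega -> R,
    [/\ forall w, 0 <= f w, cond_prob P C E f &
      forall (g : Omega -> R), measurable_wrt g -> (forall w, 0 <= g w) ->
      forall D, C D -> (\int[P]_(w in D) (f w * g w)%:E =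
                        \int[P]_(w in E `&` D) (g w)%:E)%E].
Proof.
move=> mE.
pose nu := coarse_measure sC mC (mrestr P mE).
pose mu := coarse_measure sC mC P.
have numu : nu `<< mu.
  move=> N nullN F mF FN; have muF := nullN F mF FN.
  apply: (@subset_measure0 _ _ _ P) muF => //.
  - by apply: measurableI => //; apply: mC; rewrite -coarse_measurableE.
  - by apply: mC; rewrite -coarse_measurableE.
pose f0 : Omega -> \bar R := Radon_Nikodym_SigmaFinite.f nu mu.
have f00 w : (0 <= f0 w)%E by exact: Radon_Nikodym_SigmaFinite.f_ge0.
have f0E w : (fine (f0 w))%:E = f0 w.
  by rewrite fineK//; exact: Radon_Nikodym_SigmaFinite.f_fin_num.
have mf0 : @measurable_fun _ _ (g_sigma_algebraType C) (\bar R) setT f0.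
  exact: measurable_int (Radon_Nikodym_SigmaFinite.f_integrable numu).
have mf : measurable_wrt (fine \o f0).
  move=> B mB; rewrite -coarse_measurableE// -[X in measurable X]setTI.
  have : @measurable_fun _ _ (g_sigma_algebraType C) R setT (fine \o f0).
    exact: measurableT_comp.
  by apply.
have f_int D : C D -> (\int[P]_(w in D) f0 w = P (E `&` D))%E.
  move=> CD; rewrite -(integral_coarsen sC mC P)//.
  rewrite -(@Radon_Nikodym_SigmaFinite.f_integral _ _ _ nu mu)//.
    by rewrite [LHS]/= /coarsen /mrestr setIC.
  by rewrite coarse_measurableE.
have CT : C setT by rewrite -(sigma_algebra_id sC); exact: (@measurableT _ (g_sigma_algebraType C)).
exists (fine \o f0); split.
- by move=> w; rewrite fine_ge0.
- split => //.
  + apply/integrableP; split; first exact/measurable_EFinP/measurable_wrtT.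
    rewrite (eq_integral f0) => [|w _]; last by rewrite /= ger0_norm ?f0E// fine_ge0.
    by rewrite f_int// (le_lt_trans (probability_le1 _ _)) ?ltry//; exact: measurableI.
  + by move=> D CD; rewrite (eq_integral f0) ?f_int// => w _; rewrite /= f0E.
- move=> g mg g0 D CD.
  have mD : measurable D by exact: mC.
  have mgC := measurable_wrtP mg.
  transitivity (\int[mu]_(w in D) ((g w)%:E * f0 w))%E.
    have mgf : @measurable_fun _ _ (g_sigma_algebraType C) (\bar R) setT
        (fun w => (g w)%:E * f0 w)%E.
      by apply: emeasurable_funM => //; exact/measurable_EFinP.
    have gf0 w : (0 <= (g w)%:E * f0 w)%E by rewrite mule_ge0// lee_fin.
    rewrite (integral_coarsen sC mC P CD mgf gf0).
    by apply: eq_integral => w _; rewrite EFinM /= f0E muleC.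
  rewrite Radon_Nikodym_SigmaFinite.change_of_variables//.
  + have mg' : @measurable_fun _ _ (g_sigma_algebraType C) (\bar R) setT (EFin \o g).
      exact/measurable_EFinP.
    have g0' w : (0 <= (EFin \o g) w)%E by rewrite lee_fin.
    rewrite (integral_coarsen sC mC (mrestr P mE) CD mg' g0').
    by rewrite ge0_integral_mrestr//; exact/measurable_EFinP/measurable_wrtT.
  + by rewrite coarse_measurableE.
  + by apply: measurable_funTS; exact/measurable_EFinP.
Qed.

(** It suffices that for every event E of G some function measurable for C is a
    version of the conditional probability of E given both F and C: the product
    with a version f of the conditional probability of an event of F is then
    computed by [cond_prob_density]. *)
Lemma cond_independentI F G :
  F `<=` measurable -> G `<=` measurable ->
  (forall E, G E -> exists g : Omega -> R,
    [/\ measurable_wrt g, forall w, 0 <= g w <= 1 &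
        forall D, F D \/ C D -> forall D', C D' ->
         (\int[P]_(w in D `&` D') (g w)%:E = P (D `&` D' `&` E))%E]) ->
  cond_independent P C F G.
Proof.
move=> mF mG hG E E' FE GE'.
have mE := mF _ FE; have mE' := mG _ GE'.
have [f [f0 cf fg]] := cond_prob_density mE.
have [g [mg g01 gE']] := hG _ GE'.
have g0 w : 0 <= g w by case/andP: (g01 w).
have CT : C setT by rewrite -(sigma_algebra_id sC); exact: (@measurableT _ (g_sigma_algebraType C)).
have [mf If fE] := cf.
exists f, g; split => //.
- split => //.
  + apply/integrableP; split; first exact/measurable_EFinP/measurable_wrtT.
    apply: (@le_lt_trans _ _ (\int[P]_(w in setT) (cst 1 w))%E).
      apply: ge0_le_integral => //=.
      * by apply/measurable_EFinP; apply: measurableT_comp => //; exact: measurable_wrtT.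
      * by move=> w _; rewrite lee_fin ger0_norm//; case/andP: (g01 w).
    by rewrite integral_cst// mul1e (le_lt_trans (probability_le1 P measurableT)) ?ltry.
  + move=> D CD; have := gE' setT (or_intror CT) D CD.
    by rewrite setTI setIC.
- have fgE D : C D -> (\int[P]_(w in D) (f w * g w)%:E = P (E `&` E' `&` D))%E.
    move=> CD; rewrite fg// (gE' E (or_introl FE) D CD).
    by congr (P _); rewrite -!setIA (setIC D).
  split.
  + move=> B mB; rewrite -coarse_measurableE// -[X in measurable X]setTI.
    have : @measurable_fun _ _ (g_sigma_algebraType C) R setT (f \* g).
      by apply: measurable_funM; exact: measurable_wrtP.
    by apply.
  + apply/integrableP; split.
      by apply/measurable_EFinP; apply: measurable_funM; exact: measurable_wrtT.
    under eq_integral do rewrite /= ger0_norm ?mulr_ge0//.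
    by rewrite fgE// setIT (le_lt_trans (probability_le1 _ _)) ?ltry//; exact: measurableI.
  + exact: fgE.
Qed.

End ConditionalProbability.

(** * Immersion of the chain in the innovations *)

Lemma integral_eq_mod_null (R : realType) (d : measure_display)
    (Omega : measurableType d) (P : probability Omega R) (E F : set Omega)
    (h : Omega -> \bar R) :
  measurable E -> measurable F -> eq_mod_null P E F ->
  measurable_fun setT h -> (forall w, 0 <= h w)%E ->
  (\int[P]_(w in E) h w = \int[P]_(w in F) h w)%E.
Proof.
move=> mE mF [N [mN PN] EF] mh h0.
have key D : measurable D -> (\int[P]_(w in D) h w = \int[P]_(w in D `\` N) h w)%E.
  by move=> mD; apply: ge0_negligible_integral => //; exact: measurable_funTS.
by rewrite (key E)// (key F)// EF.
Qed.

Section Immersion.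
Context (R : realType) (A : finZmodType).
Variables (P : probability (path_space A) R) (Q : probability (path_space bool) R).

Local Notation PQ := (joint P Q).

Definition joint_site (z : int * int) (w : joint_space A) : A := site z w.1.

Definition row_past (n : int) : set_system (joint_space A) :=
  site_events joint_site [set z | z.1 <= n].

Lemma measurable_joint_site z a : measurable (joint_site z @^-1` [set a]).
Proof. exact: (measurable_joint_fst (measurable_site z a)). Qed.

Lemma row_past_measurable n : row_past n `<=` measurable.
Proof. by move=> _ [z [a [_ ->]]]; exact: measurable_joint_site. Qed.

Lemma row_past_fst n E : <<s row_past n >> E ->
  exists2 E1, measurable E1 & E = fst @^-1` E1.
Proof.
move: E; apply: smallest_sub.
  split.
  - by exists set0; rewrite ?preimage_set0.
  - move=> _ [E1 mE1 ->]; exists (~` E1); first exact: measurableC.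
    by rewrite setTD preimage_setC.
  - move=> F hF; have [F1 hF1] := choice (fun n => (let: ex_intro2 E1 m e := hF n in
      ex_intro (fun E1 => measurable E1 /\ F n = fst @^-1` E1) E1 (conj m e))).
    exists (\bigcup_n F1 n); first by apply: bigcupT_measurable => k; case: (hF1 k).
    by rewrite preimage_bigcup; apply: eq_bigcupr => k _; case: (hF1 k).
move=> _ [z [a [_ ->]]]; exists (site z @^-1` [set a]) => //.
exact: measurable_site.
Qed.

Lemma fst_past n E : @past A n E -> <<s row_past n >> (fst @^-1` E).
Proof.
move: E; apply: preimage_sigma_sub; first exact: smallest_sigma_algebra.
by move=> _ [z [a [zn ->]]]; apply: sub_sigma_algebra; exists z, a.
Qed.

Lemma joint_fst E : measurable E -> PQ (fst @^-1` E) = P E.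
Proof.
move=> mE; have -> : fst @^-1` E = E `*` [set: path_space bool].
  by apply/seteqP; split => w //= [].
by rewrite joint_rectangle// (@probability_setT _ _ _ Q) mule1.
Qed.

(** As the Bernoulli field is independent of the chain, this is the conditional
    probability of E given the whole chain. *)
Definition section_prob (E : set (joint_space A)) (x : path_space A) : R :=
  fine (Q (xsection E x)).

Lemma section_probE E x : measurable E -> (section_prob E x)%:E = Q (xsection E x).
Proof.
by move=> mE; rewrite /section_prob fineK// fin_num_measure//; exact: measurable_xsection.
Qed.

Lemma section_prob01 E x : measurable E -> 0 <= section_prob E x <= 1.
Proof.
move=> mE; rewrite -!lee_fin section_probE// measure_ge0 probability_le1//.
exact: measurable_xsection.
Qed.

(** Measurability of sections is applied on the product of the chain space,
    endowed with the past alone, and of the space of the Bernoulli field: an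
    event of the joint past is measurable for this smaller product. *)
Lemma section_prob_past n E B : @joint_past A n E -> measurable B ->
  @past A n (section_prob E @^-1` B).
Proof.
move=> nE mB.
pose coarse := g_sigma_algebraType (site_events (@site A) [set z | z.1 <= n]).
have mE : measurable (E : set (coarse * path_space bool)).
  move: E nE; apply: smallest_sub; first exact: sigma_algebra_measurable.
  move=> _ [E1 [E2 [nE1 nE2 ->]]]; apply: measurableX; first exact: nE1.
  exact: past_measurable nE2.
have /= mphi := @measurable_fun_xsection _ _ coarse (path_space bool) R Q E mE.
have mfine : measurable_fun [set: coarse] (fine \o (Q \o xsection E)).
  exact: measurableT_comp.
by have := mfine measurableT B mB; rewrite setTI.
Qed.

Lemma integral_section_prob D1 E : measurable D1 -> measurable E ->
  (\int[PQ]_(w in fst @^-1` D1) (section_prob E w.1)%:E = PQ (fst @^-1` D1 `&` E))%E.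
Proof.
move=> mD1 mE.
have mphi := @measurable_fun_xsection _ _ (path_space A) (path_space bool) R Q E mE.
have phiE : EFin \o section_prob E = Q \o xsection E.
  by apply/funext => x /=; rewrite section_probE.
transitivity (\int[P]_(x in D1) (section_prob E x)%:E)%E.
  transitivity (\int[pushforward PQ fst]_(x in D1) (EFin \o section_prob E) x)%E.
    apply/esym; apply: (@ge0_integral_pushforward _ _ (joint_space A) (path_space A)
      R fst measurable_fst PQ D1 (EFin \o section_prob E)) => //.
      by rewrite phiE; exact: measurable_funTS.
    by move=> x _; rewrite lee_fin; case/andP: (section_prob01 x mE).
  by apply: eq_measure_integral => F mF _; exact: joint_fst.
rewrite [RHS]/joint /product_measure1 integral_mkcond; apply: eq_integral => x _.
rewrite patchE /= section_probE//; case: ifPn => [/set_mem xD|/negP xD].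
  congr (Q _); apply/seteqP; split => v /set_mem vE; apply/mem_set; first by split.
  by case: vE.
rewrite (_ : xsection _ x = set0) ?measure0//.
apply/seteqP; split => // v /set_mem[/= xD1 _].
by apply: xD; rewrite inE.
Qed.

(** Up to null sets, an event of the innovations up to time n belongs to the
    joint past, and its conditional probability given the chain, the measure of
    its section, depends only on the past of the chain.  The second index m is
    the time up to which the chain is observed. *)
Lemma rows_cond_independent n m :
  cond_independent PQ (null_completion PQ (row_past n))
    (null_completion PQ (row_past m))
    (null_completion PQ (@innovation_past A n)).
Proof.
have cN k := null_completion_complete PQ (@row_past_measurable k).
have mN k := null_completion_measurable (P := PQ) (@row_past_measurable k).
have mI : @innovation_past A n `<=` measurable.
  by move=> _ [z [u [_ ->]]]; exact: measurable_innovation.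
apply: cond_independentI => //; first exact: null_completion_measurable.
move=> E nE; have mE := null_completion_measurable mI nE.
have [E0 nE0 EE0] := null_completion_mod nE.
have pE0 := innovation_joint_past nE0.
have mE0 : measurable E0 by exact: (@joint_past_measurable A n).
exists (fun w => section_prob E0 w.1); split.
- move=> B mB; apply: sigma_null_completion.
  exact: (fst_past (section_prob_past pE0 mB)).
- by move=> w; exact: section_prob01.
- have lift D : (null_completion PQ (row_past m) D \/ null_completion PQ (row_past n) D) ->
      exists2 D1, measurable D1 & eq_mod_null PQ D (fst @^-1` D1).
    by case=> /null_completion_mod[D0 /row_past_fst[D1 mD1 ->] DD]; exists D1.
  move=> D nD D' nD'.
  have mD : measurable D by case: nD => /mN.
  have mD' := mN _ _ nD'.
  have [D1 mD1 DD1] := lift D nD; have [D1' mD1' DD1'] := lift D' (or_intror nD').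
  have DDe := eq_mod_nullI DD1 DD1'.
  have mpre : measurable (fst @^-1` D1 `&` fst @^-1` D1' : set (joint_space A)).
    by apply: measurableI; exact: measurable_joint_fst.
  have mDD : measurable (D `&` D') by exact: measurableI.
  have mg : measurable_fun setT (fun w : joint_space A => (section_prob E0 w.1)%:E).
    have mphi := @measurable_fun_xsection _ _ (path_space A) (path_space bool) R Q E0 mE0.
    have -> : (fun w : joint_space A => (section_prob E0 w.1)%:E) =
        (Q \o xsection E0) \o fst.
      by apply/funext => w /=; rewrite section_probE.
    exact: measurableT_comp.
  have g0 (w : joint_space A) : (0 <= (section_prob E0 w.1)%:E)%E.
    by rewrite lee_fin; case/andP: (section_prob01 w.1 mE0).
  rewrite (integral_eq_mod_null mDD mpre DDe mg g0).
  rewrite -preimage_setI integral_section_prob//; last exact: measurableI.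
  apply/esym; apply: eq_mod_null_measure; last by rewrite preimage_setI; exact: eq_mod_nullI.
    by apply: measurableI => //; exact: measurableI.
  by apply: measurableI => //; rewrite preimage_setI.
Qed.

End Immersion.

(** * Dynamics and isomorphism *)

Section Dynamics.
Context (R : realType) (A : finZmodType).

Lemma iterz_row_shift (B : finZmodType) i (x : path_space B) n j :
  iterz (row_shift B) i x n j = x n (j + i).
Proof.
case: i => k /=.
  elim: k j => [|k IHk] j; first by rewrite addr0.
  by rewrite iterS [LHS]/row_shift_fwd IHk -addrA -intS.
rewrite -[row_shift_bwd _]/(iter k.+1 (@row_shift_bwd B) x) NegzE.
elim: k.+1 j => [|{}k IHk] j; first by rewrite oppr0 addr0.
by rewrite iterS [LHS]/row_shift_bwd IHk -addrA -opprD -intS.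
Qed.

Lemma measurable_chain_row n : measurable_fun setT (@chain_row A n).
Proof. by move=> _ B mB; rewrite setTI; exact: (measurable_coord mB). Qed.

Lemma chain_filtrationE (P : probability (path_space A) R) k :
  chain_filtration P k =
  null_completion P (site_events (@site A) [set z | z.1 <= - k%:Z]).
Proof. exact: Sigma_rows. Qed.

(** The two descriptions of the generators differ by the change of index from
    the nonpositive time m to the natural number -m. *)
Lemma rows_generated (d : measure_display) (Omega : measurableType d)
    (P : probability Omega R) (f : Omega -> path_space A) :
  generated_by P (fun k => null_completion P
      (site_events (fun z w => site z (f w)) [set z | z.1 <= - k%:Z]))
    (fun k w => chain_row (- k%:Z) (f w)).
Proof.
move=> k; rewrite Sigma_rows; congr null_completion; apply/seteqP; split => E.
  move=> [[m i] [a [/= mk ->]]]; exists (`|m|%N, i), a; split => /=; first by lia.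
  by apply/seteqP; split => w /=; rewrite /site /chain_row /= (_ : - `|m|%N%:Z = m) //; lia.
move=> [[l i] [a [/= kl ->]]]; exists (- l%:Z, i), a; split => //=.
by lia.
Qed.

Lemma site_events_filtration (B : finType) (d : measure_display)
    (Omega : measurableType d) (P : probability Omega R) (Y : int * int -> Omega -> B) :
  (forall z b, measurable (Y z @^-1` [set b])) ->
  filtration P (fun k => null_completion P (site_events Y [set z | z.1 <= - k%:Z])).
Proof.
move=> mY; split=> k.
  by apply: null_completion_complete => _ [z [b [_ ->]]].
apply: sub_sigma_algebra2; apply: setSU; apply: site_events_sub => z /= zk.
by lia.
Qed.

Lemma row_shift_dynamical (P : probability (path_space A) R) :
  (forall E, measurable E -> P (row_shift A @^-1` E) = P E) ->
  dynamical_system P (row_shift A).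
Proof.
move=> PT; split => //; first exact: polish_path_space.
  exact: measurable_row_shift.
exact: measurable_row_shift_bwd.
Qed.

Lemma site_events_factor (B : finType) (d : measure_display)
    (Omega : measurableType d) (P : probability Omega R) (T : invertible_map Omega)
    (Y : int * int -> Omega -> B) (D : set int) :
  (forall z b, measurable (Y z @^-1` [set b])) ->
  dynamical_system P T ->
  (forall n i w, Y (n, i) (T w) = Y (n, i + 1) w) ->
  (forall n i w, Y (n, i) (bwd T w) = Y (n, i - 1) w) ->
  factor_sigma P T (null_completion P (site_events Y [set z | D z.1])).
Proof.
move=> mY [_ mT mTi PT] YT YTi; apply: null_completion_factor => //.
- by move=> _ [z [b [_ ->]]].
- move=> _ [[n i] [b [Dn ->]]]; exists (n, i + 1), b; split => //.
  by apply/seteqP; split => w /=; rewrite YT.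
- move=> _ [[n i] [b [Dn ->]]]; exists (n, i - 1), b; split => //.
  by apply/seteqP; split => w /=; rewrite YTi.
Qed.

Lemma chain_factor_filtration (P : probability (path_space A) R) :
  (forall E, measurable E -> P (row_shift A @^-1` E) = P E) ->
  factor_filtration P (row_shift A) (chain_filtration P).
Proof.
move=> PT; have dP := row_shift_dynamical PT.
have -> : chain_filtration P = fun k =>
    null_completion P (site_events (@site A) [set z | z.1 <= - k%:Z]).
  by apply/funext => k; exact: chain_filtrationE.
split => //; first exact: (site_events_filtration P (@measurable_site A)).
by move=> k; apply: (@site_events_factor A _ _ P (row_shift A) (@site A)
  [set n | n <= - k%:Z] (@measurable_site A) dP).
Qed.

Definition joint_shift_fwd (w : joint_space A) : joint_space A :=
  (row_shift_fwd w.1, row_shift_fwd w.2).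
Definition joint_shift_bwd (w : joint_space A) : joint_space A :=
  (row_shift_bwd w.1, row_shift_bwd w.2).

Lemma joint_shift_fwdK : cancel joint_shift_fwd joint_shift_bwd.
Proof.
by case=> x v; rewrite /joint_shift_fwd /joint_shift_bwd /= !row_shift_fwdK.
Qed.

Lemma joint_shift_bwdK : cancel joint_shift_bwd joint_shift_fwd.
Proof.
by case=> x v; rewrite /joint_shift_fwd /joint_shift_bwd /= !row_shift_bwdK.
Qed.

Definition joint_shift : invertible_map (joint_space A) :=
  InvertibleMap joint_shift_fwdK joint_shift_bwdK.

Lemma iterz_joint_shift i w : (iterz joint_shift i w).1 = iterz (row_shift A) i w.1.
Proof.
case: i => k /=; first by elim: k => [//|k IHk] /=; rewrite IHk.
by congr row_shift_bwd; elim: k => [//|k IHk] /=; rewrite IHk.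
Qed.

Variables (P : probability (path_space A) R) (Q : probability (path_space bool) R).
Hypothesis PT : forall E, measurable E -> P (row_shift A @^-1` E) = P E.
Hypothesis QT : forall E, measurable E -> Q (row_shift bool @^-1` E) = Q E.

Lemma measurable_joint_shift : measurable_fun setT (fwd joint_shift).
Proof.
apply: measurable_fun_pair; apply: measurableT_comp => //.
  exact: measurable_row_shift.
exact: measurable_row_shift.
Qed.

Lemma measurable_joint_shift_bwd : measurable_fun setT (bwd joint_shift).
Proof.
apply: measurable_fun_pair; apply: measurableT_comp => //.
  exact: measurable_row_shift_bwd.
exact: measurable_row_shift_bwd.
Qed.

(** A product of invariant measures is invariant: compare on rectangles. *)
Lemma joint_shift_preserving E :
  measurable E -> joint P Q (joint_shift @^-1` E) = joint P Q E.
Proof.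
move=> mE; apply/esym.
have mS := measurable_joint_shift.
apply: (@product_measure_unique _ _ (path_space A) (path_space bool) R P Q
  (pushforward (joint P Q) (fwd joint_shift))) => // E1 E2 mE1 mE2.
rewrite [LHS]/= /pushforward.
rewrite (_ : _ @^-1` _ = (row_shift A @^-1` E1) `*` (row_shift bool @^-1` E2)) //.
rewrite joint_rectangle.
- by rewrite PT// QT.
- by rewrite -[X in measurable X]setTI; exact: measurable_row_shift.
- by rewrite -[X in measurable X]setTI; exact: measurable_row_shift.
Qed.

Lemma joint_dynamical : dynamical_system (joint P Q) joint_shift.
Proof.
split; [exact: polish_pair_space|exact: measurable_joint_shift| |].
  exact: measurable_joint_shift_bwd.
exact: joint_shift_preserving.
Qed.

Lemma innovation_shift n i w :
  innovation (n, i) (joint_shift w) = innovation (n, i + 1) w :> option A.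
Proof. by []. Qed.

Lemma innovation_shift_bwd n i w :
  innovation (n, i) (bwd joint_shift w) = innovation (n, i - 1) w :> option A.
Proof. by rewrite /= /row_shift_bwd (addrAC i 1). Qed.

Lemma innovation_factor D : factor_sigma (joint P Q) joint_shift
  (null_completion (joint P Q) (site_events (@innovation A) [set z | D z.1])).
Proof.
apply: site_events_factor; first exact: measurable_innovation.
- exact: joint_dynamical.
- exact: innovation_shift.
- exact: innovation_shift_bwd.
Qed.

Definition innovation_filtration (k : nat) : set_system (joint_space A) :=
  null_completion (joint P Q) (@innovation_past A (- k%:Z)).

Lemma innovation_factor_filtration :
  factor_filtration (joint P Q) joint_shift innovation_filtration.
Proof.
split; first exact: joint_dynamical.
  exact: (site_events_filtration (joint P Q) (@measurable_innovation A)).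
by move=> k; exact: (innovation_factor [set n | n <= - k%:Z]).
Qed.

Definition row_filtration (k : nat) : set_system (joint_space A) :=
  null_completion (joint P Q) (@row_past A (- k%:Z)).

Lemma row_factor_filtration :
  factor_filtration (joint P Q) joint_shift row_filtration.
Proof.
split; first exact: joint_dynamical.
  exact: (site_events_filtration (joint P Q) (@measurable_joint_site A)).
move=> k; apply: (@site_events_factor _ _ _ _ _ _ [set n | n <= - k%:Z]) => //.
  exact: measurable_joint_site.
exact: joint_dynamical.
Qed.

(** Both processes are made of the rows of the chain, and the law of the first
    coordinate of the joint space is P. *)
Lemma rows_isomorphic :
  dynamically_isomorphic P (row_shift A) (joint P Q) joint_shift
    (chain_filtration P) row_filtration.
Proof.
exists _, (fun=> discrete A), (fun k x => chain_row (- k%:Z) x),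
  (fun k w => chain_row (- k%:Z) w.1); split.
- by move=> _; exact: polish_discrete.
- split => k; split.
  + exact: measurable_chain_row.
  + by move=> i x; rewrite /chain_row iterz_row_shift add0r.
  + by apply: measurableT_comp => //; exact: measurable_chain_row.
  + by move=> i w; rewrite /chain_row iterz_joint_shift iterz_row_shift add0r.
- split; last exact: (@rows_generated _ _ (joint P Q) fst).
  move=> k; rewrite chain_filtrationE.
  exact: (@rows_generated _ _ P id).
- move=> B mB; rewrite /pushforward.
  set X := fun w : path_space A => _.
  have mX : measurable (X @^-1` B).
    move: B mB; apply: preimage_sigma_sub; first exact: sigma_algebra_measurable.
    move=> _ [k _ [B mB <-]]; rewrite setTI.
    exact: (measurable_coord mB).
  exact/esym/(joint_fst P Q mX).
Qed.

End Dynamics.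

(** * Product type and standardness *)

Lemma bernoulli_shift_preserving (R : realType) (beta : R)
    (Q : probability (path_space bool) R) :
  (forall s a, uniq s ->
    Q (cyl (@site bool) s a) = (\prod_(z <- s) bernoulli_weight beta (a z))%:E) ->
  forall E, measurable E -> Q (row_shift bool @^-1` E) = Q E.
Proof.
move=> hQ; have mS := @measurable_row_shift bool.
rewrite measurable_path_space.
apply: (@cyl_unique R _ (path_space bool) _ bool (@site bool) (@measurable_site bool) setT
  (pushforward Q (fwd (row_shift bool))) Q).
  by rewrite /= /pushforward preimage_setT probability_setT ltry.
move=> s a _ us; rewrite [LHS]/= /pushforward row_shift_cyl hQ.
  rewrite big_map; apply: etrans (esym (hQ s a us)); congr (_%:E); apply: eq_bigr => -[n i] _.
  by rewrite /= addrK.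
by rewrite map_inj_uniq// => -[n i] [m j] [-> /addIr ->].
Qed.

Section Standard.
Context (R : realType) (A : finZmodType) (eps beta : R).
Variables (P : probability (path_space A) R) (Q : probability (path_space bool) R).
Variables (mu nu : probability (row_space A) R).
Hypothesis A2 : (2 <= #|A|)%N.
Hypothesis eps01 : 0 <= eps <= 1.
Hypothesis beta01 : 0 <= beta <= 1.
Hypothesis eps_beta : (1 - eps) * beta = eps / (#|A|%:R - 1).
Hypothesis subcritical : 2 * (1 - eps - eps / (#|A|%:R - 1)) < 1.
Hypothesis hmu : iid_law (uniform_pmf R (A := A)) mu.
Hypothesis hnu : iid_law (noise_pmf eps (A := A)) nu.
Hypothesis hP : stationary_chain mu (tau_kernel nu) P.
Hypothesis hQ : forall s a, uniq s ->
  Q (cyl (@site bool) s a) = (\prod_(z <- s) bernoulli_weight beta (a z))%:E.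

Local Notation PQ := (joint P Q).

Let PT E : measurable E -> P (row_shift A @^-1` E) = P E.
Proof. exact: (row_shift_preserving hmu hnu hP). Qed.

Let QT E : measurable E -> Q (row_shift bool @^-1` E) = Q E.
Proof. exact: (bernoulli_shift_preserving hQ). Qed.

Lemma innovation_blank n i C : @joint_past A n C ->
  PQ (C `&` innovation (n + 1, i) @^-1` [set None]) =
  ((1 - eps - eps / (#|A|%:R - 1))%:E * PQ C)%E.
Proof.
move=> nC.
have := @innovation_step R A eps beta P Q mu nu A2 eps01 beta01 eps_beta hnu hP hQ
  n [:: i] (fun=> None) C erefl nC.
rewrite big_seq1 /= => <-; congr (PQ (_ `&` _)); apply/seteqP; split => w h.
  by move=> j; rewrite inE => /eqP ->.
by apply: h; rewrite mem_head.
Qed.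

Lemma rows_decoded k : row_filtration P Q k `<=` innovation_filtration P Q k.
Proof.
apply: sub_null_completion => _ [z [a [zk ->]]].
apply: (@site_decoded R A _ PQ _ innovation_blank) => //; split => //.
exact: (@innovation_weight_ge0 R A eps beta A2 eps01 beta01 eps_beta None).
Qed.

Definition innovation_layer (k : nat) : set_system (joint_space A) :=
  null_completion PQ (@innovation_row A (- k%:Z)).

Lemma innovation_row_measurable n : @innovation_row A n `<=` measurable.
Proof. by move=> _ [z [u [_ ->]]]; exact: measurable_innovation. Qed.

Lemma innovation_layer_mod k n E : - k%:Z <= n -> innovation_layer k E ->
  exists2 E0, <<s @innovation_row A (- k%:Z) >> E0 /\ @joint_past A n E0 &
    eq_mod_null PQ E E0.
Proof.
move=> kn /null_completion_mod[E0 kE0 EE0]; exists E0 => //; split => //.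
apply: innovation_joint_past; move: kE0; apply: sub_sigma_algebra2.
by apply: site_events_sub => z /= ->.
Qed.

Lemma bigcap_cons (E : nat -> set (joint_space A)) k (s : seq nat) :
  \bigcap_(l in [set` k :: s]) E l = E k `&` \bigcap_(l in [set` s]) E l.
Proof.
apply/seteqP; split => w h.
  split; first by apply: h; rewrite /= mem_head.
  by move=> l sl; apply: h; rewrite /= inE; apply/orP; right.
case: h => hk hs l; rewrite /= inE => /orP[/eqP->//|sl].
exact: hs.
Qed.

(** Larger indices are earlier times: the layers with indices beyond k only
    concern the times up to -(k + 1). *)
Lemma later_layers_mod k (s : seq nat) (E : nat -> set (joint_space A)) :
  (forall l, l \in s -> (k < l)%N /\ innovation_layer l (E l)) ->
  exists2 E0, @joint_past A (- k.+1%:Z) E0 &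
    eq_mod_null PQ (\bigcap_(l in [set` s]) E l) E0.
Proof.
elim: s => [|l s IHs] sE.
  exists setT; first exact: (@measurableT _ (g_sigma_algebraType _)).
  rewrite (_ : \bigcap_(_ in _) _ = setT); first exact: eq_mod_null_refl.
  by apply/seteqP; split.
have [|E0 kE0 EE0] := IHs; first by move=> j js; apply: sE; rewrite inE js orbT.
have [kl lE] := sE l (mem_head _ _).
have [|E1 [_ kE1] EE1] := @innovation_layer_mod l (- k.+1%:Z) _ _ lE; first by lia.
exists (E1 `&` E0); first exact: sigma_setI.
by rewrite bigcap_cons; exact: eq_mod_nullI.
Qed.

(** The indices are sorted, which lists the layers from the latest to the
    earliest one; the first of them is then independent of the joint past that
    contains all the others. *)
Lemma innovation_layer_independent : independent PQ innovation_layer.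
Proof.
have sorted_case (s : seq nat) (E : nat -> set (joint_space A)) : sorted ltn s ->
    (forall k, k \in s -> innovation_layer k (E k)) ->
    PQ (\bigcap_(k in [set` s]) E k) = (\prod_(k <- s) PQ (E k))%E.
  elim: s => [|k s IHs] /= ss sE.
    rewrite big_nil (_ : \bigcap_(_ in _) _ = setT) ?jointT//.
    by apply/seteqP; split.
  have sE' l : l \in s -> (k < l)%N /\ innovation_layer l (E l).
    move=> ls; split; last by apply: sE; rewrite inE ls orbT.
    by have /allP := order_path_min ltn_trans ss; exact.
  rewrite big_cons -IHs ?(path_sorted ss)//; last by move=> l /sE'[].
  have mL l F : innovation_layer l F -> measurable F.
    exact: (null_completion_measurable (@innovation_row_measurable _)).
  have [E0 kE0 EE0] := later_layers_mod sE'.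
  have kE := sE k (mem_head _ _).
  have [|E1 [kE1 _] EE1] := @innovation_layer_mod k (- k%:Z) _ _ kE => //.
  have mE0 : measurable E0 by exact: (@joint_past_measurable A (- k.+1%:Z)).
  have mE1 : measurable E1.
    exact: (@site_events_measurable _ (joint_space A) _ (option A) _
      (@measurable_innovation A) [set z | z.1 = - k%:Z]).
  have mS : measurable (\bigcap_(l in [set` s]) E l).
    by apply: bigcap_measurableType => l /= /sE'[_ /mL].
  have mk := mL _ _ kE.
  rewrite bigcap_cons (eq_mod_null_measure (measurableI _ _ mk mS)
    (measurableI _ _ mE1 mE0) (eq_mod_nullI EE1 EE0)).
  rewrite (eq_mod_null_measure mk mE1 EE1) (eq_mod_null_measure mS mE0 EE0).
  rewrite setIC muleC.
  apply: (@innovation_independent R A eps beta P Q mu nu A2 eps01 beta01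
    eps_beta hnu hP hQ (- k.+1%:Z)) => //.
  by rewrite (_ : - k.+1%:Z + 1 = - k%:Z)//; lia.
move=> s E us sE; pose t := sort leq s.
have st : perm_eq t s by rewrite perm_sort.
have -> : \bigcap_(k in [set` s]) E k = \bigcap_(k in [set` t]) E k.
  by congr (\bigcap_(k in _) E k); apply/seteqP; split => k /=; rewrite (perm_mem st).
rewrite -(perm_big _ st); apply: sorted_case.
  by rewrite ltn_sorted_uniq_leq sort_uniq us sort_sorted//; exact: leq_total.
by move=> k; rewrite (perm_mem st); exact: sE.
Qed.

Lemma innovation_product_type :
  product_type PQ (joint_shift A) (innovation_filtration P Q).
Proof.
exists innovation_layer; split.
- move=> k; exact: (innovation_factor PT QT [set n | n = - k%:Z]).
- exact: innovation_layer_independent.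
- move=> k; apply/seteqP; split; apply: smallest_sub; try exact: smallest_sigma_algebra.
  + move=> E [[z [u [/= zk ->]]]|nE].
      apply: sub_sigma_algebra; exists `|z.1|%N; first by rewrite /=; lia.
      apply: sub_sigma_algebra; left; exists z, u; split => //=; lia.
    apply: sub_sigma_algebra; exists k; first exact: leqnn.
    by apply: sub_sigma_algebra; right.
  + move=> E [l /= kl]; apply: sub_sigma_algebra2; apply: setSU.
    by apply: site_events_sub => z /= ->; lia.
Qed.

Lemma chain_standard :
  dynamically_standard P (row_shift A) (chain_filtration P).
Proof.
exists _, (joint_space A), PQ, (joint_shift A), (innovation_filtration P Q); split.
- exact: (innovation_factor_filtration PT QT).
- exact: innovation_product_type.
- exists (row_filtration P Q); split.
  + exact: (row_factor_filtration PT QT).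
  + exact: rows_isomorphic.
  + split; first exact: rows_decoded.
    by move=> k; exact: rows_cond_independent.
Qed.

End Standard.

Theorem theorem3p17 (R : realType) (A : finZmodType) (hA : (2 <= #|A|)%N) :
  exists eps0 : R,
    0 < eps0 < (#|A|%:R - 1) / #|A|%:R /\
    forall eps : R, eps0 < eps <= (#|A|%:R - 1) / #|A|%:R ->
    forall P : probability (path_space A) R, chain_law eps P ->
      factor_filtration P (row_shift A) (chain_filtration P) /\
      dynamically_standard P (row_shift A) (chain_filtration P).
Proof.
pose N : R := #|A|%:R.
have N2 : 2 <= N by rewrite /N ler_nat.
have N0 : 0 < N by lra.
have N1 : 0 < N - 1 by lra.
exists ((N - 1) / (2 * N)); split.
  rewrite divr_gt0 ?mulr_gt0//=.
  by rewrite ltr_pM2l// ltf_pV2 ?posrE ?mulr_gt0//; lra.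
move=> eps /andP[e0 e1] P [mu [nu [hmu hnu hP]]].
split; first exact: chain_factor_filtration (row_shift_preserving hmu hnu hP).
have eN : eps * N <= N - 1 by rewrite -ler_pdivlMr.
have e0N : N - 1 < eps * (2 * N) by rewrite -ltr_pdivrMr// mulr_gt0.
have eps0 : 0 < eps by apply: lt_trans e0; rewrite divr_gt0 ?mulr_gt0.
have eps1 : 0 < 1 - eps.
  by rewrite subr_gt0 -(ltr_pM2r N0) mul1r; apply: le_lt_trans eN _; lra.
pose r := eps / (N - 1).
(* r <= 1 - eps amounts to eps N <= N - 1, and 2 rho < 1 to eps > (N - 1) / (2
   N). *)
have rE : r * (N - 1) = eps by rewrite /r divfK// gt_eqF.
have r0 : 0 < r by rewrite divr_gt0.
have r1 : r <= 1 - eps.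
  rewrite -(ler_pM2r N1) rE mulrBl mul1r; lra.
have beta01 : 0 <= r / (1 - eps) <= 1.
  by rewrite divr_ge0 ?(ltW r0) ?(ltW eps1)//= ler_pdivrMr// mul1r.
have [Q hQ] := exists_bernoulli beta01.
apply: (@chain_standard R A eps (r / (1 - eps)) P Q mu nu) => //.
- by rewrite (ltW eps0)/= -subr_ge0 (ltW eps1).
- by rewrite mulrC divfK// gt_eqF.
- rewrite -/N -/r -(ltr_pM2r N1) mul1r.
  by rewrite -mulrA mulrBl rE; lra.
Qed.
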